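(* There is a universal constant $c>0$ such that the following holds for every $K\ge2$, every horizon $T$, every instance, every $C\ge0$ and every attack policy whose total attack is at most $C$. If the algorithm SE-WR is run with input $C$ and confidence parameter $\delta\in(0,1)$, then with probability at least $1-\delta$ its realized regret satisfies $$R_T\le c\left(\sum_{k\ne k^*}\frac{\log(KT/\delta)}{\Delta_k}+KC\right).$$ Moreover, when $T>K$ and $\delta=K/T$, its pseudo-regret satisfies $$\bar R_T\le c\left(\sum_{k\ne k^*}\frac{\log T}{\Delta_k}+KC\right).$$
   Context: Stochastic multi-armed bandit with adversarial attacks. There are $K$ arms $\mathcal K=\{1,\dots,K\}$; arm $k$ has a reward distribution on $[0,1]$ with unknown mean $\mu_k$ (the tuple of distributions is the instance), and rewards $X_{k,t}$ are drawn independently over rounds $t$ from arm $k$'s distribution. The arm of highest mean $k^*$ is assumed unique, and $\Delta_k=\mu_{k^*}-\mu_k$. In each round $t=1,\dots,T$: the learner pulls an arm $I_t$; the reward $X_{I_t,t}$ is drawn; the adversary observes $I_t$ and $X_{I_t,t}$ (and the past) and chooses an attacked reward $\tilde X_{I_t,t}$; the learner observes only $\tilde X_{I_t,t}$. The total attack is $\sum_{t=1}^T|X_{I_t,t}-\tilde X_{I_t,t}|$. Realized regret: $R_T=\max_{k\in\mathcal K}\sum_{t=1}^T(X_{k,t}-X_{I_t,t})$ (raw rewards). Pseudo-regret: $\bar R_T=\mathbb E\big[T\mu_{k^*}-\sum_{t=1}^T\mu_{I_t}\big]$. Algorithm SE-WR (inputs $C,K,T,\delta$): initialize $\mathcal S=\mathcal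 K$, $N_k=0$, $\tilde\mu_k=0$ for all $k$. Until $T$ rounds have been used, repeat: pull each arm in $\mathcal S$ once; for $k\in\mathcal S$ increase $N_k$ by $1$ and let $\tilde\mu_k$ be the empirical mean of the attacked rewards observed from arm $k$ so far; set $\tilde\mu_{\max}=\max_k\tilde\mu_k$; replace $\mathcal S$ by $$\Big\{k\in\mathcal S:\ \tilde\mu_k\ge\tilde\mu_{\max}-2\Big(\sqrt{\tfrac{\log(2KT/\delta)}{N_k}}+\tfrac{C}{N_k}\Big)\Big\}.$$ *)

(* Defs.v *)
From HB Require Import structures.
From mathcomp Require Import all_boot all_order all_algebra.
From mathcomp Require Import all_classical all_reals all_analysis.
Import Order.TTheory GRing.Theory Num.Theory.
Import numFieldNormedType.Exports.

Set Implicit Arguments.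
Unset Strict Implicit.
Unset Printing Implicit Defensive.

Local Open Scope classical_set_scope.
Local Open Scope ring_scope.

(* The arms are 'I_K. Rounds are numbered from 0, so that a horizon T means
   the rounds t < T. All histories are lists with the most recent round at
   the head. *)

(* Seeding the maximum with the value at an actual arm k0 makes this the true
   maximum of f, also for negative values; it does not depend on k0. *)
Definition max_arm (R : realType) (K : nat) (k0 : 'I_K) (f : 'I_K -> R) : R :=
  \big[Num.max/f k0]_(k < K) f k.

(* What the learner sees of a round: the arm and the attacked reward. *)
Definition observation (R : realType) (K : nat) : Type := ('I_K * R)%type.

Definition num_pulls (R : realType) (K : nat)
    (h : seq (observation R K)) (k : 'I_K) : nat :=
  count (fun o => o.1 == k) h.

(* Equal to 0 when k has not been pulled, since x / 0 = 0. *)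
Definition emp_mean (R : realType) (K : nat)
    (h : seq (observation R K)) (k : 'I_K) : R :=
  (\sum_(o <- h | o.1 == k) o.2) / (num_pulls h k)%:R.

Definition wide_radius (R : realType) (K T : nat) (C delta : R) (n : nat) : R :=
  Num.sqrt (ln (2 * K%:R * T%:R / delta) / n%:R) + C / n%:R.

Definition survivors (R : realType) (K T : nat) (C delta : R)
    (h : seq (observation R K)) (S : {set 'I_K}) : {set 'I_K} :=
  [set k in S | max_arm k (emp_mean h)
                - 2 * wide_radius K T C delta (num_pulls h k)
                <= emp_mean h k].

(* The set of active arms, the arms of the current pass over it that are still
   to be pulled, and the number of completed passes. *)
Record sewr_state (K : nat) := SEWRState {
  active : {set 'I_K};
  queue : seq 'I_K;
  pass : nat }.

(* The order in which a pass visits the active arms is unspecified by SE-WR: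
   order p S lists the arms of S in the order used in pass p. *)
Definition pull_order (K : nat) : Type := nat -> {set 'I_K} -> seq 'I_K.

Definition valid_pull_order (K : nat) (order : pull_order K) : Prop :=
  forall (p : nat) (S : {set 'I_K}), perm_eq (order p S) (enum S).

(* h includes the observation just made for the arm at the head of the queue.
   The counts and means are recomputed from h at the end of each pass; arms
   outside S keep their old values and still take part in the maximum. *)
Definition sewr_step (R : realType) (K T : nat) (C delta : R)
    (order : pull_order K) (h : seq (observation R K)) (st : sewr_state K) :
    sewr_state K :=
  match behead (queue st) with
  | [::] => let S := survivors T C delta h (active st) in
            SEWRState S (order (pass st).+1 S) (pass st).+1
  | q => SEWRState (active st) q (pass st)
  end.

Fixpoint sewr_run (R : realType) (K T : nat) (C delta : R)
    (order : pull_order K) (h : seq (observation R K)) : sewr_state K :=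
  match h with
  | [::] => SEWRState [set: 'I_K]%SET (order 0%N [set: 'I_K]%SET) 0%N
  | _ :: h' => sewr_step T C delta order h (sewr_run T C delta order h')
  end.

(* Stale means of eliminated arms can (on atypical samples) empty the active
   set, after which SE-WR prescribes nothing: the arm k0 is then pulled. *)
Definition sewr (R : realType) (K T : nat) (C delta : R)
    (order : pull_order K) (k0 : 'I_K) (h : seq (observation R K)) : 'I_K :=
  head k0 (queue (sewr_run T C delta order h)).

(* A past round as the adversary sees it: (arm, (raw, attacked) rewards). *)
Definition event (R : realType) (K : nat) : Type := ('I_K * (R * R))%type.

Definition observed (R : realType) (K : nat) (e : event R K) :
    observation R K := (e.1, e.2.2).

(* pol u h i r is the attacked reward chosen after arm i has been pulled and
   has produced the raw reward r, where h is the past and u is the adversary's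
   private randomness. *)
Definition attack_policy (R : realType) (K : nat) (U : Type) : Type :=
  U -> seq (event R K) -> 'I_K -> R -> R.

(* Arms are discrete, so measurability is required in the seed and in all the
   rewards, for every number n of past rounds and every sequence of arms. *)
Definition measurable_policy (R : realType) (K : nat) (dU : measure_display)
    (U : measurableType dU) (pol : attack_policy R K U) : Prop :=
  forall (n : nat) (a : n.-tuple 'I_K) (i : 'I_K),
    measurable_fun [set: (U * n.-tuple (R * R) * R)%type]
      (fun p : U * n.-tuple (R * R) * R => pol p.1.1 (zip a p.1.2) i p.2).

(* The interaction for a fixed reward table x (x k t is the reward of arm k in
   round t) and a fixed seed u: the history of the first t rounds. *)
Fixpoint transcript (R : realType) (K : nat) (U : Type)
    (learner : seq (observation R K) -> 'I_K) (pol : attack_policy R K U)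
    (u : U) (x : 'I_K -> nat -> R) (t : nat) : seq (event R K) :=
  match t with
  | 0 => [::]
  | t'.+1 =>
      let h := transcript learner pol u x t' in
      let i := learner (map (@observed R K) h) in
      (i, (x i t', pol u h i (x i t'))) :: h
  end.

Definition pulled (R : realType) (K : nat) (U : Type)
    (learner : seq (observation R K) -> 'I_K) (pol : attack_policy R K U)
    (u : U) (x : 'I_K -> nat -> R) (t : nat) : 'I_K :=
  learner (map (@observed R K) (transcript learner pol u x t)).

Definition total_attack (R : realType) (K : nat) (U : Type)
    (learner : seq (observation R K) -> 'I_K) (pol : attack_policy R K U)
    (u : U) (x : 'I_K -> nat -> R) (T : nat) : R :=
  \sum_(e <- transcript learner pol u x T) `|e.2.1 - e.2.2|.

(* k0 is only the seed of max_arm. *)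
Definition realized_regret (R : realType) (K : nat) (k0 : 'I_K)
    (x : 'I_K -> nat -> R) (I : nat -> 'I_K) (T : nat) : R :=
  max_arm k0 (fun k => \sum_(t < T) (x k t - x (I t) t)).

(* An instance is the tuple nu of the reward distributions. *)
Definition arm_mean (R : realType) (K : nat) (nu : 'I_K -> probability R R)
    (k : 'I_K) : R := Rintegral (nu k) setT (fun y : R => y).

Definition unit_supported (R : realType) (K : nat)
    (nu : 'I_K -> probability R R) : Prop :=
  forall k, nu k `[0, 1]%classic = 1%E.

Definition unique_best_arm (R : realType) (K : nat)
    (nu : 'I_K -> probability R R) (kstar : 'I_K) : Prop :=
  forall k, k != kstar -> arm_mean nu k < arm_mean nu kstar.

Definition gap (R : realType) (K : nat) (nu : 'I_K -> probability R R)
    (kstar k : 'I_K) : R := arm_mean nu kstar - arm_mean nu k.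

Definition mutually_independent (R : realType) (d : measure_display)
    (Omega : measurableType d) (P : probability Omega R) (J : finType)
    (F : J -> set (set Omega)) : Prop :=
  forall (B : {set J}) (E : J -> set Omega),
    (forall j, j \in B -> F j (E j)) ->
    P (\bigcap_(j in [set` B]) E j) = (\prod_(j in B) P (E j))%E.

(* None stands for the adversary's seed, Some t for round t. *)
Definition round_sigma (R : realType) (d : measure_display)
    (Omega : measurableType d) (dU : measure_display) (U : measurableType dU)
    (K T : nat) (seed : Omega -> U) (X : 'I_K -> nat -> Omega -> R)
    (j : option 'I_T) : set (set Omega) :=
  match j with
  | None => preimage_set_system setT seed measurable
  | Some t => g_sigma_preimage (fun k : 'I_K => X k t)
  end.

(* In every round t < T each arm k is distributed according to nu k; distinct
   rounds are independent of each other and of the adversary's seed. Nothing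
   is assumed on the joint law of the arms within one round. *)
Definition bandit_rewards (R : realType) (d : measure_display)
    (Omega : measurableType d) (P : probability Omega R)
    (dU : measure_display) (U : measurableType dU) (K T : nat)
    (nu : 'I_K -> probability R R) (seed : Omega -> U)
    (X : 'I_K -> nat -> {RV P >-> R}) : Prop :=
  (forall (k : 'I_K) (t : nat), (t < T)%N ->
     forall B : set R, measurable B -> distribution P (X k t) B = nu k B) /\
  mutually_independent P (@round_sigma R d Omega dU U K T seed X).

(* I w t is the arm pulled in round t at the sample point w. *)
Definition pseudo_regret (R : realType) (d : measure_display)
    (Omega : measurableType d) (P : probability Omega R) (K : nat)
    (nu : 'I_K -> probability R R) (kstar : 'I_K)
    (I : Omega -> nat -> 'I_K) (T : nat) : \bar R :=
  'E_P[(fun w => T%:R * arm_mean nu kstar - \sum_(t < T) arm_mean nu (I w t))].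

(* Main.v *)
Require Import Defs.
From HB Require Import structures.
From mathcomp Require Import all_boot all_order all_algebra.
From mathcomp Require Import ring lra.
From mathcomp Require Import all_classical all_reals all_analysis.
From mathcomp Require Import measurable_realfun.
Import Order.TTheory GRing.Theory Num.Theory.
Import numFieldNormedType.Exports.

(* Freedman-type exponential supermartingales, fed by Hoeffding's lemma, give
   two kinds of deviation bounds that hold jointly with probability at least
   1 - 3 delta / 4. Let L = log(2KT/delta).

   (1) For every arm and every n <= T, the raw empirical mean of the first n
   pulls is within sqrt(L/n) of the true mean; the attack shifts it by at most
   C/n. The stale mean of an eliminated arm is then at most the best mean, so
   the best arm is never eliminated, and an arm surviving its n-th pass has gap
   at most 4 (sqrt(L/n) + C/n), i.e. n <= 64 L / gap^2 + 8 C / gap. Summing over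
   the arms bounds the regret in terms of means.

   (2) For every arm k, the sum over rounds of the centered difference between
   the rewards of k and of the pulled arm I_t is at most
   lam/2 #{t : I_t <> k} + log(2K/delta)/lam. For k <> k* take lam = gap k: the
   first term is absorbed by the drift -T gap k. For k = k* take lam = the
   smallest gap: it is absorbed by the regret in terms of means. Hence the
   realized regret exceeds the latter by no more than a constant factor and
   log-over-gap terms.

   Independence enters through the sigma-algebra of the past: histories of arms
   take finitely many values and are measurable for it, so each step of the
   supermartingale is a finite sum over histories. *)

Set Implicit Arguments.
Unset Strict Implicit.
Unset Printing Implicit Defensive.

Local Open Scope classical_set_scope.
Local Open Scope ring_scope.

(** * Hoeffding's lemma *)

Section hoeffding_real.
Variable R : realType.
Implicit Types (m x z : R).

(** The moment generating function at [x] of the Bernoulli law of mean [m]. *)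
Let D m x : R := 1 - m + m * expR x.

Let D_gt0 m x : 0 <= m <= 1 -> 0 < D m x.
Proof.
move=> /andP[m0 m1]; rewrite /D; have := expR_gt0 x => ex.
have [->|mn0] := eqVneq m 0; first by rewrite mul0r; lra.
have : 0 < m * expR x by rewrite mulr_gt0// lt0r mn0.
by lra.
Qed.

Let is_derive_D m x : is_derive x 1 (D m) (m * expR x).
Proof.
by rewrite /D; apply: is_derive_eq; rewrite /GRing.scale/= ?mulr1; ring.
Qed.

(** The expression is the derivative of [x * m + x ^+ 2 / 8 - ln (D m x)]. It vanishes at 0, and its
    own derivative is [1 / 4 - p * (1 - p)], a quarter of a square, with
    [p = m * expR x / D m x]. *)
Let slope_ge0 m x : 0 <= m <= 1 -> 0 <= x ->
  0 <= m + x / 4 - m * expR x / D m x.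
Proof.
move=> m01 x0.
pose q y : R := m + y / 4 - m * expR y / D m y.
have dq (y : R) : is_derive y 1 q
    (1 / 4 - (m * expR y / D m y) * (1 - m * expR y / D m y)).
  have Dy0 : D m y != 0 by rewrite gt_eqF// D_gt0.
  have ? := is_derive_D m y.
  have ? : is_derive y 1 (fun y => (D m y)^-1) (- (D m y) ^- 2 *: (m * expR y)).
    exact: is_deriveV.
  rewrite /q; apply: is_derive_eq.
  rewrite /GRing.scale/= !(mulr0, add0r, mul1r, mulr1).
  have E (d e : R) : d != 0 ->
      4^-1 - (m * e * (- d ^- 2 * (m * e)) + d^-1 * (m * e)) =
      4^-1 - m * e / d * (1 - m * e / d) by move=> d0; field.
  exact: E.
have -> : 0 = q 0.
  by rewrite /q /D expR0 mulr1 subrK divr1 mul0r addr0 subrr.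
apply: (@ger0_derive1_ndecry _ q 0) => //.
- move=> y _; rewrite derive1E; have [_ ->] := dq y.
  set p := m * _ / _; have := sqr_ge0 (2 * p - 1); lra.
- apply: continuous_subspaceT => y.
  by apply/differentiable_continuous/derivable1_diffP; have [] := dq y.
Qed.

(* The cumulant generating function of a Bernoulli law has second derivative
   p (1 - p) <= 1/4. *)
Let bernoulli_mgf_ge0 m x : 0 <= m <= 1 -> 0 <= x ->
  1 - m + m * expR x <= expR (x * m + x ^+ 2 / 8).
Proof.
move=> m01 x0; rewrite -/(D m x).
rewrite -[leLHS]lnK ?posrE ?D_gt0// ler_expR.
pose g y : R := y * m + y ^+ 2 / 8 - ln (D m y).
have dg (y : R) : is_derive y 1 g (m + y / 4 - m * expR y / D m y).
  have ? := is_derive_D m y.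
  have ? : is_derive y 1 (fun y => ln (D m y)) ((D m y)^-1 * (m * expR y)).
    have ? : is_derive (D m y) 1 (@ln R) (D m y)^-1.
      by apply: is_derive1_ln; exact: D_gt0.
    exact: (@is_derive1_comp _ (@ln R) (D m)).
  rewrite /g; apply: is_derive_eq.
  rewrite /GRing.scale/= !(mulr0, add0r, mul1r, mulr1).
  have E (d e : R) : d != 0 ->
      m + 8^-1 * (y + y) - d^-1 * (m * e) = m + y / 4 - m * e / d.
    by move=> d0; field.
  by apply: E; rewrite gt_eqF// D_gt0.
suff : 0 <= g x by rewrite /g subr_ge0.
have -> : 0 = g 0.
  by rewrite /g /D expR0 mulr1 subrK ln1; lra.
apply: (@ger0_derive1_ndecry _ g 0) => //.
- move=> y; rewrite in_itv/= andbT => y0; rewrite derive1E; have [_ ->] := dg y.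
  exact/slope_ge0/ltW.
- apply: continuous_subspaceT => y.
  by apply/differentiable_continuous/derivable1_diffP; have [] := dg y.
Qed.

Lemma bernoulli_mgf_le m x : 0 <= m <= 1 ->
  1 - m + m * expR x <= expR (x * m + x ^+ 2 / 8).
Proof.
move=> /andP[m0 m1]; have [x0|/ltW x0] := leP 0 x.
  by apply: bernoulli_mgf_ge0 => //; rewrite m0.
(* Negative [x]: exchange the outcomes 0 and 1 of the Bernoulli law, then multiply by [expR x]. *)
have := @bernoulli_mgf_ge0 (1 - m) (- x); rewrite oppr_ge0 => /(_ _ x0).
have -> : 0 <= 1 - m <= 1 by lra.
move=> /(_ isT); rewrite -(ler_pM2l (expR_gt0 x)) mulrDr mulrCA -!expRD.
by rewrite subrr expR0; congr (_ <= expR _); lra.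
Qed.

Lemma expR_chord x z : 0 <= z <= 1 -> expR (x * z) <= 1 - z + z * expR x.
Proof.
(* The tangent lines of expR at x * z give both terms on the right. *)
move=> /andP[z0 z1]; set a := expR (x * z).
have ez : a * expR (- (x * z)) = 1 by rewrite -expRD subrr expR0.
have ex : a * expR (x - x * z) = expR x by rewrite -expRD addrC subrK.
rewrite -ex -[in leRHS]ez; have a0 : 0 < a := expR_gt0 _.
have := ler_wpM2l z0 (ler_wpM2l (ltW a0) (expR_ge1Dx (x - x * z))).
have z1' : 0 <= 1 - z by lra.
have := ler_wpM2l z1' (ler_wpM2l (ltW a0) (expR_ge1Dx (- (x * z)))).
by rewrite ez; nra.
Qed.

End hoeffding_real.

(** * Pulls of suboptimal arms on concentrated histories *)

Lemma max_arm_le (R : realType) (K : nat) (k0 : 'I_K) (f : 'I_K -> R) (a : R) :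
  (max_arm k0 f <= a) <-> (forall k, f k <= a).
Proof.
split=> [h k|h].
  by apply: le_trans h; apply: le_bigmax.
by apply: bigmax_le.
Qed.

Lemma le_max_arm (R : realType) (K : nat) (k0 k : 'I_K) (f : 'I_K -> R) :
  f k <= max_arm k0 f.
Proof. exact: le_bigmax. Qed.

Section sewr_analysis.
Variables (R : realType) (K T : nat) (C delta : R) (order : pull_order K).
Variables (k0 kstar : 'I_K) (mu : 'I_K -> R).
Variable h : nat -> seq (observation R K).

Let run t := sewr_run T C delta order (h t).
Let gap k := mu kstar - mu k.
Let L := ln (2 * K%:R * T%:R / delta).
Let rad := wide_radius K T C delta.

Definition pull_bound (k : 'I_K) : R := 64 * L / gap k ^+ 2 + 8 * C / gap k.

Hypotheses (C0 : 0 <= C) (L0 : 0 <= L) (order_valid : valid_pull_order order).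
Hypothesis kstar_best : forall k, k != kstar -> mu k < mu kstar.
Hypothesis h0 : h 0 = [::].
Hypothesis hS : forall t, exists r,
  h t.+1 = (sewr T C delta order k0 (h t), r) :: h t.
Hypothesis concentrated : forall t k, (t <= T)%N -> (0 < num_pulls (h t) k)%N ->
  `|emp_mean (h t) k - mu k| <= rad (num_pulls (h t) k).

Let mu_le k : mu k <= mu kstar.
Proof. by have [->//|/kstar_best/ltW] := eqVneq k kstar. Qed.

Let pull_bound_ge0 k : k != kstar -> 0 <= pull_bound k.
Proof.
move=> /kstar_best kb; have g0 : 0 < gap k by rewrite subr_gt0.
by rewrite addr_ge0// ?divr_ge0 ?mulr_ge0 ?exprn_ge0// ltW.
Qed.

Let rad_ge0 n : 0 <= rad n.
Proof. by rewrite addr_ge0 ?sqrtr_ge0// divr_ge0. Qed.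

(** Beyond [pull_bound k] pulls, both terms of the radius are below [gap k / 8], so that
    [4 * rad n < gap k]. *)
Lemma le_pull_bound k n : k != kstar -> (0 < n)%N -> gap k <= 4 * rad n ->
  n%:R <= pull_bound k.
Proof.
move=> /kstar_best kb n0 gr; have g0 : 0 < gap k by rewrite subr_gt0.
have n0' : 0 < n%:R :> R by rewrite ltr0n.
rewrite leNgt; apply/negP => nB.
have L1 : 0 <= 64 * L / gap k ^+ 2.
  by rewrite divr_ge0 ?mulr_ge0 ?exprn_ge0// ltW.
have C1 : 0 <= 8 * C / gap k by rewrite divr_ge0 ?mulr_ge0// ltW.
have h1 : 64 * L / gap k ^+ 2 < n%:R by apply: le_lt_trans nB; rewrite lerDl.
have h2 : 8 * C / gap k < n%:R by apply: le_lt_trans nB; rewrite lerDr.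
move: gr; rewrite leNgt => /negP; apply; rewrite /rad /wide_radius -/L.
have -> : gap k = 4 * (gap k / 8 + gap k / 8) by field.
rewrite ltr_pM2l// ltrD//.
  rewrite -[ltRHS]ger0_norm ?divr_ge0 ?ltW// -sqrtr_sqr ltr_sqrt; last first.
    by rewrite exprn_gt0// divr_gt0.
  rewrite ltr_pdivrMr// expr_div_n mulrC.
  by move: h1; rewrite ltr_pdivrMr ?exprn_gt0//; lra.
rewrite ltr_pdivrMr//; move: h2; rewrite ltr_pdivrMr//; lra.
Qed.

(** Invariant of a run. The nonempty queue keeps the fallback arm [k0] out of play. An active arm
    has one pull per completed pass, and one more once it has left the queue. The means of
    eliminated arms are frozen at most at the best mean, so that they cannot eliminate [kstar]
    later. The 1 in the last clause pays for a pass begun after the last survived test. *)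
Let inv t := let st := run t in let S := active st in let q := queue st in
  [/\ kstar \in S, q != [::], uniq q, {subset q <= S} &
  [/\ forall k, k \in S -> num_pulls (h t) k = (pass st + (k \notin q))%N,
     forall k, k \notin S -> emp_mean (h t) k <= mu kstar,
     forall k, k \in S -> k != kstar -> (pass st)%:R <= pull_bound k &
     forall k, k != kstar -> (num_pulls (h t) k)%:R <= 1 + pull_bound k]].

Let num_pulls_cons i r (s : seq (observation R K)) k :
  num_pulls ((i, r) :: s) k = ((i == k) + num_pulls s k)%N.
Proof. by []. Qed.

Let emp_mean_cons i r (s : seq (observation R K)) k : i != k ->
  emp_mean ((i, r) :: s) k = emp_mean s k.
Proof.
move=> /negbTE ik; rewrite /emp_mean num_pulls_cons ik add0n.
by rewrite (big_cons _ _ (i, r)) /= ik.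
Qed.

Let inv0 : inv 0.
Proof.
rewrite /inv /run h0/=.
have po := order_valid 0 [set: 'I_K]%SET.
split; rewrite ?inE//.
- apply/eqP => q0; have := perm_mem po kstar.
  by rewrite q0 mem_enum !inE.
- by rewrite (perm_uniq po) enum_uniq.
- by move=> k _; rewrite inE.
- split.
  + by move=> k _; rewrite (perm_mem po) mem_enum inE.
  + by move=> k; rewrite inE.
  + by move=> k _ /pull_bound_ge0.
  + by move=> k /pull_bound_ge0 ?; rewrite /num_pulls/= ler_wpDr.
Qed.

Let invS t : (t < T)%N -> inv t -> inv t.+1.
Proof.
move=> tT [kS q0 uq qS [cnt stale psb cntb]].
have [r hE] := hS t.
have runE : run t.+1 = sewr_step T C delta order (h t.+1) (run t).
  by rewrite /run hE.
have : sewr T C delta order k0 (h t) = head k0 (queue (run t)) by [].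
move: runE kS q0 uq qS cnt stale psb; rewrite /inv.
case: (run t) => S [|i q] p //= runE kS _ /andP[iq uq] qS cnt stale psb sE.
rewrite sE in hE; have iS : i \in S by apply: qS; rewrite inE eqxx.
have cnt' k : k \in S -> num_pulls (h t.+1) k = (p + (k \notin q))%N.
  move=> kS'; rewrite hE num_pulls_cons cnt// inE negb_or (eq_sym k i).
  by case: eqVneq => [<-|] //=; rewrite iq addn0 addnC.
have stale' k : k \notin S -> emp_mean (h t.+1) k <= mu kstar.
  by move=> kS'; rewrite hE emp_mean_cons ?stale//; apply: contraNneq kS' => <-.
have cntb' k : k != kstar -> (num_pulls (h t.+1) k)%:R <= 1 + pull_bound k.
  move=> kk; have [kS'|kS'] := boolP (k \in S).
    rewrite cnt'// natrD addrC lerD ?psb//.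
    by case: (k \notin q); rewrite ?lexx ?ler01.
  rewrite hE num_pulls_cons; case: eqVneq => [ik|_]; last exact: cntb.
  by rewrite -ik iS in kS'.
have qS' : {subset q <= S} by move=> x xq; apply: qS; rewrite inE xq orbT.
(* In mid-pass only the data of arm [i] change; when [i] was the last of its pass, the elimination
   test takes place. *)
have [q0|q0] := eqVneq q [::]; last first.
  have -> : run t.+1 = SEWRState S q p.
    by rewrite runE /sewr_step/=; case: q q0 {iq uq qS cnt cnt' qS' runE sE}.
  by split.
have -> : run t.+1 = SEWRState (survivors T C delta (h t.+1) S)
    (order p.+1 (survivors T C delta (h t.+1) S)) p.+1.
  by rewrite runE /sewr_step/= q0.
set S' := survivors _ _ _ _ _; have po := order_valid p.+1 S'.
have {}cnt' k : k \in S -> num_pulls (h t.+1) k = p.+1.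
  by move=> /cnt'; rewrite q0 addn1.
have conc k : k \in S -> `|emp_mean (h t.+1) k - mu k| <= rad p.+1.
  by move=> kS'; have := @concentrated t.+1 k tT; rewrite cnt'//; apply.
(* The maximum in the test also ranges over eliminated arms, whose stale means are covered by
   [stale']. *)
have emp_le k : emp_mean (h t.+1) k <= mu kstar + rad p.+1.
  have [kS'|/stale' e] := boolP (k \in S); last exact: ler_wpDr.
  have := conc _ kS'; have := mu_le k; rewrite ler_norml; lra.
have inS' k : (k \in S') = (k \in S) &&
    (max_arm k (emp_mean (h t.+1)) - 2 * rad p.+1 <= emp_mean (h t.+1) k).
  by rewrite inE; case: (boolP (k \in S)) => //= kS'; rewrite cnt'.
have maxle k : max_arm k (emp_mean (h t.+1)) <= mu kstar + rad p.+1.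
  exact/max_arm_le.
(* The empirical mean of [kstar] is at least [mu kstar - rad p.+1], hence within twice the radius of
   the maximum. *)
have kS'' : kstar \in S'.
  rewrite inS' kS/=; have := conc _ kS; have := maxle kstar.
  by rewrite ler_norml; lra.
split => //=.
- by apply/eqP => o0; have := perm_mem po kstar; rewrite o0 mem_enum kS''.
- by rewrite (perm_uniq po) enum_uniq.
- by move=> k; rewrite (perm_mem po) mem_enum.
- split => //.
  + move=> k kS'; rewrite (perm_mem po) mem_enum kS' addn0 cnt'//.
    by move: kS'; rewrite inS' => /andP[].
  (* An arm eliminated now has empirical mean below the maximum minus twice the radius, thus below
     [mu kstar - rad p.+1]. *)
  + move=> k; rewrite inS'; have [kS'/=|/stale'//] := boolP (k \in S).
    rewrite -ltNge; have := maxle k; have := rad_ge0 p.+1; lra.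
  (* A survivor satisfies [gap k <= 4 * rad p.+1]: two radii from the test and one from each of the
     means of [k] and [kstar]. *)
  + move=> k; rewrite inS' => /andP[kS' sk] kk; apply: le_pull_bound => //.
    have := conc _ kS'; have := conc _ kS.
    have := le_max_arm k kstar (emp_mean (h t.+1)).
    by rewrite !ler_norml /gap; lra.
Qed.

Lemma num_pulls_bound t k : (t <= T)%N -> k != kstar ->
  (num_pulls (h t) k)%:R <= 1 + pull_bound k.
Proof.
move=> tT; suff [_ _ _ _ [_ _ _]] : inv t by apply.
by elim: t tT => [_|t IH tT]; [exact: inv0|exact/invS/IH/ltnW].
Qed.

End sewr_analysis.

(** * Measurability of the interaction *)

(** Measurability for maps into types without a sigma-algebra, such as arm lists and algorithm
    states: finitely many values, each with a measurable fibre. *)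
Definition finitely_measurable d (Om : measurableType d) (T : Type)
    (f : Om -> T) : Prop :=
  finite_set (range f) /\ forall y, measurable (f @^-1` [set y]).

Section finitely_measurable.
Context d (Om : measurableType d).
Implicit Types T S : Type.

Lemma finitely_measurable_cst T (y : T) :
  finitely_measurable (fun _ : Om => y).
Proof.
split=> [|z]; first by apply: (sub_finite_set _ (finite_set1 y)) => _ [w _ <-].
have [->|yz] := pselect (y = z).
  by rewrite (_ : _ @^-1` _ = setT)//; apply/seteqP; split.
by rewrite (_ : _ @^-1` _ = set0)//; apply/seteqP; split.
Qed.

(** The sample space splits into the finitely many fibres of [f], on each of which the first
    argument of [g] is constant. *)
Lemma finitely_measurable_bind T S (f : Om -> T) (g : T -> Om -> S) :
  finitely_measurable f -> (forall y, range f y -> finitely_measurable (g y)) ->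
  finitely_measurable (fun w => g (f w) w).
Proof.
move=> [finf mf] gm; split.
  apply: (@sub_finite_set _ _ (\bigcup_(y in range f) range (g y))).
    by move=> _ [w _ <-]; exists (f w) => //; exists w.
  by apply: bigcup_finite => // y /gm[].
move=> z; rewrite (_ : _ @^-1` _ =
    \bigcup_(y in range f) (f @^-1` [set y] `&` g y @^-1` [set z])).
  by apply: fin_bigcup_measurable => // y /gm[_ ?]; exact: measurableI.
apply/seteqP; split=> [w <-|w [_ _ [<- //]]].
by exists (f w) => //; split.
Qed.

Lemma measurable_fun_finitely_measurable_bind d' (S : measurableType d') T
    (f : Om -> T) (g : T -> Om -> S) :
  finitely_measurable f ->
  (forall y, range f y -> measurable_fun setT (g y)) ->
  measurable_fun setT (fun w => g (f w) w).
Proof.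
move=> [finf mf] gm _ B mB; rewrite setTI.
rewrite (_ : _ @^-1` _ =
    \bigcup_(y in range f) (f @^-1` [set y] `&` g y @^-1` B)).
  apply: fin_bigcup_measurable => // y /gm my; apply: measurableI => //.
  by rewrite -[X in measurable X]setTI; exact: my.
apply/seteqP; split=> [w wB|w [_ _ [<- //]]].
by exists (f w) => //; split.
Qed.

Lemma finitely_measurable_map T S (f : Om -> T) (g : T -> S) :
  finitely_measurable f -> finitely_measurable (fun w => g (f w)).
Proof.
move=> fm; apply: (finitely_measurable_bind fm (g := fun y _ => g y)) => y _.
exact: finitely_measurable_cst.
Qed.

Lemma finitely_measurable_setP (J : finType) (A : {set J})
    (b : J -> Om -> bool) :
  (forall j, measurable_fun setT (b j)) ->
  finitely_measurable (fun w => [set j in A | b j w]%SET).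
Proof.
move=> mb; split=> [|B]; first by apply: (sub_finite_set (@subsetT _ _)).
rewrite (_ : _ @^-1` _ =
    \bigcap_(j in setT) [set w | (j \in A) && b j w = (j \in B)]).
  apply: fin_bigcap_measurable => // j _.
  have := measurable_and (measurable_cst (j \in A)) (mb j).
  by move=> /(_ measurableT [set (j \in B)] I); rewrite setTI.
apply/seteqP; split=> [w <- j _ /=|w wB]; first by rewrite !inE.
by apply/setP => j; rewrite inE; exact: (wB j).
Qed.

End finitely_measurable.

(** * Measurability of the decisions of SE-WR *)

Section sewr_measurable.
Context d (Om : measurableType d) (R : realType) (K T : nat) (C delta : R)
  (order : pull_order K) (k0 : 'I_K).
Implicit Types o : seq ('I_K * (Om -> R)).

(** A history with deterministic arms and random rewards: pull counts are constant in [w], and only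
    the empirical means vary. *)
Let obs_at (w : Om) o : seq (observation R K) := [seq (p.1, p.2 w) | p <- o].

Let num_pulls_at w o k : num_pulls (obs_at w o) k = count (fun p => p.1 == k) o.
Proof. by rewrite /num_pulls count_map. Qed.

Let measurable_emp_mean o k :
  (forall i, measurable_fun setT (nth (k, cst 0) o i).2) ->
  measurable_fun setT (fun w => emp_mean (obs_at w o) k).
Proof.
move=> mo; rewrite /emp_mean; apply/measurable_funM => //.
  rewrite [X in measurable_fun _ X](_ : _ = fun w => \sum_(0 <= i < size o)
      (if (nth (k, cst 0) o i).1 == k then (nth (k, cst 0) o i).2 w else 0)).
    by apply: measurable_sum => i; case: (_.1 == k) => //; exact: mo.
  apply/funext => w.
  by rewrite big_map (big_nth (k, cst 0 : Om -> R)) big_mkcond.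
rewrite [X in measurable_fun _ X](_ : _ =
  cst (count (fun p => p.1 == k) o)%:R^-1)//.
by apply/funext => w; rewrite num_pulls_at.
Qed.

Let measurable_max_arm k (f : 'I_K -> Om -> R) :
  (forall i, measurable_fun setT (f i)) ->
  measurable_fun setT (fun w => max_arm k (f ^~ w)).
Proof.
move=> mf; rewrite /max_arm; elim: (index_enum _) => [|i s IH].
  by under eq_fun do rewrite big_nil; exact: mf.
by under eq_fun do rewrite big_cons; exact: measurable_maxr.
Qed.

Let finitely_measurable_run o :
  (forall i k, measurable_fun setT (nth (k, cst 0) o i).2) ->
  finitely_measurable (fun w => sewr_run T C delta order (obs_at w o)).
Proof.
elim: o => [|p o IH] mo; first exact: finitely_measurable_cst.
rewrite /=; apply: (finitely_measurable_bind (g := fun st w =>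
  sewr_step T C delta order (obs_at w (p :: o)) st)).
  by apply: IH => i; exact: mo i.+1.
move=> st _; rewrite /sewr_step; case: (behead _) => [|j q]; last first.
  exact: finitely_measurable_cst.
apply: (finitely_measurable_map
  (fun S => SEWRState S (order (pass st).+1 S) (pass st).+1)).
set o' := p :: o in mo *.
apply: finitely_measurable_setP => k; apply: measurable_fun_ler.
  apply: measurable_funB.
    by apply: measurable_max_arm => j; exact: measurable_emp_mean.
  rewrite [X in measurable_fun _ X](_ : _ =
    cst (2 * wide_radius K T C delta (count (fun p => p.1 == k) o')))//.
  by apply/funext => w; rewrite num_pulls_at.
exact: measurable_emp_mean.
Qed.

Lemma finitely_measurable_sewr o :
  (forall i k, measurable_fun setT (nth (k, cst 0) o i).2) ->
  finitely_measurable (fun w =>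
    sewr T C delta order k0 [seq (p.1, p.2 w) | p <- o]).
Proof.
move=> mo; apply: (finitely_measurable_map (fun st => head k0 (queue st))).
exact: finitely_measurable_run.
Qed.

End sewr_measurable.

(** * Histories as functions of the sample point *)

Section transcript.
Variables (Om : Type) (R : realType) (K : nat) (U : Type)
  (pol : attack_policy R K U) (learner : seq (observation R K) -> 'I_K)
  (u : Om -> U) (X : 'I_K -> nat -> Om -> R).

Definition arms (w : Om) (t : nat) : seq 'I_K :=
  map fst (transcript learner pol (u w) (fun k t => X k t w) t).

(* The raw and attacked rewards as functions on the sample space, had the arms
   been pulled in the order a, whatever the learner does. *)
Fixpoint reward_funs (a : seq 'I_K) : seq ((Om -> R) * (Om -> R)) :=
  match a with
  | [::] => [::]
  | i :: a' => let g := reward_funs a' in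
    (X i (size a'), fun w =>
      pol (u w) (zip a' [seq (f.1 w, f.2 w) | f <- g]) i (X i (size a') w)) :: g
  end.

Lemma size_reward_funs a : size (reward_funs a) = size a.
Proof. by elim: a => //= i a ->. Qed.

Lemma size_arms w t : size (arms w t) = t.
Proof. by elim: t => //= t IH; rewrite size_map/= -{2}IH size_map. Qed.

Lemma armsS w t : arms w t.+1 =
  pulled learner pol (u w) (fun k t => X k t w) t :: arms w t.
Proof. by []. Qed.

(** Separates the two sources of randomness: the sequence of arms, which takes finitely many values,
    and the rewards along a given sequence, which are measurable functions. *)
Lemma transcript_arms w t :
  transcript learner pol (u w) (fun k t => X k t w) t =
  zip (arms w t) [seq (f.1 w, f.2 w) | f <- reward_funs (arms w t)].
Proof.
elim: t => [//|t IH]; by rewrite armsS /= -IH size_arms.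
Qed.

End transcript.

Section transcript_measurable.
Context d (Om : measurableType d) (R : realType) (K : nat)
  dU (U : measurableType dU) (pol : attack_policy R K U)
  (learner : seq (observation R K) -> 'I_K)
  (u : Om -> U) (X : 'I_K -> nat -> Om -> R).
Local Notation arms := (arms pol learner u X).
Local Notation reward_funs := (reward_funs pol u X).

Hypothesis mpol : measurable_policy pol.
Hypothesis mu : measurable_fun setT u.

Lemma measurable_reward_funs a :
  (forall k t, (t < size a)%N -> measurable_fun setT (X k t)) ->
  forall i,
    measurable_fun setT (nth (cst 0, cst 0) (reward_funs a) i).1 /\
    measurable_fun setT (nth (cst 0, cst 0) (reward_funs a) i).2.
Proof.
elim: a => [|i a IH] mX; first by move=> j; rewrite nth_nil.
have {}IH := IH (fun k t tl => mX k t (ltnW tl)).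
case=> [|j]; last exact: IH.
split=> /=; first exact: mX.
have sg : size (reward_funs a) == size a by rewrite size_reward_funs.
pose g := Tuple sg.
have mg : measurable_fun setT
    (fun w => [tuple of [seq (f.1 w, f.2 w) | f <- g]]).
  apply/measurable_fun_tnthP => j /=.
  rewrite [X in measurable_fun _ X](_ : _ =
      fun w => ((tnth g j).1 w, (tnth g j).2 w)); last first.
    by apply/funext => w /=; rewrite tnth_map.
  have [m1 m2] := IH j.
  by rewrite (tnth_nth (cst 0, cst 0)); exact: measurable_fun_pair.
apply: (measurableT_comp (mpol (in_tuple a) i)
  (g := fun w =>
    (u w, [tuple of [seq (f.1 w, f.2 w) | f <- g]], X i (size a) w))).
by apply: measurable_fun_pair; [exact: measurable_fun_pair|exact: mX].
Qed.

Hypothesis mlearner : forall o : seq ('I_K * (Om -> R)),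
  (forall i k, measurable_fun setT (nth (k, cst 0) o i).2) ->
  finitely_measurable (fun w => learner [seq (p.1, p.2 w) | p <- o]).

(** An arm is chosen before its reward is drawn, so the first [t] arms depend on the rewards of the
    first [t.-1] rounds only. This off-by-one makes the arm of the current round part of the
    past. *)
Lemma finitely_measurable_arms t :
  (forall k s, (s < t.-1)%N -> measurable_fun setT (X k s)) ->
  finitely_measurable (arms ^~ t).
Proof.
elim: t => [|t IH] mX; first exact: finitely_measurable_cst.
pose next a w := learner (map (@observed R K)
    (zip a [seq (f.1 w, f.2 w) | f <- reward_funs a])).
rewrite [X in finitely_measurable X](_ : _ =
    fun w => next (arms w t) w :: arms w t); last first.
  by apply/funext => w; rewrite armsS /pulled transcript_arms.
apply: (finitely_measurable_bind (g := fun a w => next a w :: a)).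
  by apply: IH => k s st; apply: mX; rewrite (leq_trans st)// leq_pred.
move=> _ [w0 _ <-]; move: (arms w0 t) (size_arms pol learner u X w0 t) => a sa.
apply: (finitely_measurable_map (fun i => i :: a)); rewrite /next.
have mr i : measurable_fun setT (nth (cst 0, cst 0) (reward_funs a) i).2.
  apply: (proj2 (measurable_reward_funs _ i)) => k s.
  by rewrite sa; exact: mX.
have -> : (fun w => learner (map (@observed R K)
    (zip a [seq (f.1 w, f.2 w) | f <- reward_funs a]))) =
  (fun w => learner [seq (p.1, p.2 w) | p <- zip a (map snd (reward_funs a))]).
  apply/funext => w; congr learner.
  by elim: a (reward_funs a) {sa mr} => [|i a IHa] [|f g]//=; rewrite IHa.
apply: mlearner => i k.
have : size a = size (reward_funs a) by rewrite size_reward_funs.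
elim: a (reward_funs a) i mr {sa} => [|j a IHa] [|f g]// [|i]//= mr sz.
- exact: (mr 0%N).
- by apply: IHa; [move=> l; exact: (mr l.+1)|case: sz].
Qed.

Lemma finitely_measurable_pulled (k0 : 'I_K) t :
  (forall k s, (s < t)%N -> measurable_fun setT (X k s)) ->
  finitely_measurable
    (fun w => pulled learner pol (u w) (fun k t => X k t w) t).
Proof.
move=> mX; exact: (finitely_measurable_map (head k0)
  (finitely_measurable_arms (t := t.+1) mX)).
Qed.

End transcript_measurable.

(** * Hoeffding bounds and independence of the past *)

Section hoeffding.
Context d (Om : measurableType d) (R : realType) (P : probability Om R).
Local Open Scope ereal_scope.

(* Clipping to [0, 1]; the identity on almost every sample of a law supported
   there, and it spares almost-everywhere side conditions. *)
Definition clip (y : R) : R := Num.min 1%R (Num.max 0%R y).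

Lemma clip01 y : (0 <= clip y <= 1)%R.
Proof. by rewrite /clip ge_min lexx le_min ler01 le_max lexx. Qed.

Lemma clip_id y : (0 <= y <= 1)%R -> clip y = y.
Proof. by move=> /andP[y0 y1]; rewrite /clip (max_idPr y0) (min_idPr y1). Qed.

Lemma measurable_clip : measurable_fun setT clip.
Proof. by apply: measurable_minr => //; exact: measurable_maxr. Qed.

(** Additivity for nonnegative integrands, applied to [(1 - Y) + Y = 1]. *)
Lemma integral_1B (Y : Om -> R) (m : R) : measurable_fun setT Y ->
  (forall w, 0 <= Y w <= 1)%R -> \int[P]_w (Y w)%:E = m%:E ->
  \int[P]_w (1 - Y w)%:E = (1 - m)%:E.
Proof.
move=> mY Y01 Ym.
have : \int[P]_w ((1 - Y w)%:E + (Y w)%:E) = 1.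
  under eq_integral do rewrite -EFinD subrK.
  by rewrite integral_cst//= mul1e probability_setT.
rewrite ge0_integralD//=.
- rewrite Ym; move: (\int[P]_w _) => [r| |]//; rewrite -EFinD => -[<-].
  by rewrite addrK.
- by move=> w _; rewrite lee_fin subr_ge0; case/andP: (Y01 w).
- by apply/measurable_EFinP; exact: measurable_funB.
- by move=> w _; rewrite lee_fin; case/andP: (Y01 w).
- exact/measurable_EFinP.
Qed.

Lemma mean01 (Y : Om -> R) (m : R) : measurable_fun setT Y ->
  (forall w, 0 <= Y w <= 1)%R -> \int[P]_w (Y w)%:E = m%:E -> (0 <= m <= 1)%R.
Proof.
move=> mY Y01 Ym; have Ym' := integral_1B mY Y01 Ym.
apply/andP; split; first rewrite -lee_fin -Ym.
  by apply: integral_ge0 => w _; rewrite lee_fin; case/andP: (Y01 w).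
rewrite -subr_ge0 -lee_fin -Ym'.
by apply: integral_ge0 => w _; rewrite lee_fin subr_ge0; case/andP: (Y01 w).
Qed.

(** By convexity [expR (x * Y)] lies below its chord on [0, 1]; the mean of the chord is the
    Bernoulli moment generating function, bounded by [bernoulli_mgf_le]. *)
Lemma hoeffding_unit (Y : Om -> R) (m x : R) : measurable_fun setT Y ->
  (forall w, 0 <= Y w <= 1)%R -> \int[P]_w (Y w)%:E = m%:E ->
  \int[P]_w (expR (x * (Y w - m)))%:E <= (expR (x ^+ 2 / 8))%:E.
Proof.
move=> mY Y01 Ym; have m01 := mean01 mY Y01 Ym.
have mE : measurable_fun setT (fun w => expR (x * Y w)).
  by apply: measurableT_comp => //; exact: measurable_funM.
under eq_integral.
  move=> w _; rewrite mulrBr expRD EFinM muleC.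
  over.
rewrite ge0_integralZl//=.
- apply: (@le_trans _ _
    ((expR (- (x * m)))%:E * ((1 - m + m * expR x)%:E))); last first.
    rewrite -EFinM lee_fin -ler_pdivlMl ?expR_gt0// -expRN opprK -expRD.
    exact: bernoulli_mgf_le.
  rewrite lee_pmul2l// ?lte_fin ?expR_gt0//.
  apply: (@le_trans _ _ (\int[P]_w ((1 - Y w)%:E + (expR x)%:E * (Y w)%:E))).
    apply: ge0_le_integral => //=.
    + exact/measurable_EFinP.
    + apply: emeasurable_funD; apply/measurable_EFinP.
        exact: measurable_funB.
      exact: measurable_funM.
    + move=> w _; rewrite -EFinM -EFinD lee_fin [(expR x * _)%R]mulrC.
      exact: expR_chord.
  rewrite ge0_integralD//=.
  + rewrite (integral_1B mY Y01 Ym) ge0_integralZl//=.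
    * by rewrite Ym -EFinM -EFinD mulrC.
    * exact/measurable_EFinP.
    * by move=> w _; rewrite lee_fin; case/andP: (Y01 w).
  + by move=> w _; rewrite lee_fin subr_ge0; case/andP: (Y01 w).
  + by apply/measurable_EFinP; exact: measurable_funB.
  + by move=> w _; rewrite mule_ge0// lee_fin; case/andP: (Y01 w).
  + by apply/measurable_EFinP; exact: measurable_funM.
- exact/measurable_EFinP.
Qed.

(** The variable [V = (Y + 1 - Z) / 2] again lies in [0, 1], and the centered difference is twice
    the centered [V]. The joint law of [Y] and [Z] is arbitrary, as is that of the arms within a
    round. *)
Lemma hoeffding_diff (Y Z : Om -> R) (m n x : R) :
  measurable_fun setT Y -> (forall w, 0 <= Y w <= 1)%R ->
  \int[P]_w (Y w)%:E = m%:E ->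
  measurable_fun setT Z -> (forall w, 0 <= Z w <= 1)%R ->
  \int[P]_w (Z w)%:E = n%:E ->
  \int[P]_w (expR (x * (Y w - m - (Z w - n))))%:E <= (expR (x ^+ 2 / 2))%:E.
Proof.
move=> mY Y01 Ym mZ Z01 Zn.
pose V w : R := (2^-1 * (Y w + (1 - Z w)))%R.
have mV : measurable_fun setT V.
  apply: measurable_funM => //; apply: measurable_funD => //.
  exact: measurable_funB.
have V01 w : (0 <= V w <= 1)%R by rewrite /V; have := Y01 w; have := Z01 w; lra.
have EV : \int[P]_w (V w)%:E = (2^-1 * (m + (1 - n)))%:E.
  under eq_integral do rewrite /V EFinM EFinD.
  rewrite ge0_integralZl//=.
  - rewrite ge0_integralD//=; first by rewrite Ym (integral_1B mZ Z01 Zn).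
    + by move=> w _; rewrite lee_fin; case/andP: (Y01 w).
    + exact/measurable_EFinP.
    + by move=> w _; rewrite lee_fin subr_ge0; case/andP: (Z01 w).
    + by apply/measurable_EFinP; exact: measurable_funB.
  - apply: emeasurable_funD; apply/measurable_EFinP => //.
    exact: measurable_funB.
  - move=> w _; rewrite -EFinD lee_fin; have := Y01 w; have := Z01 w; lra.
have := hoeffding_unit (x * 2) mV V01 EV.
have -> : ((x * 2) ^+ 2 / 8 = x ^+ 2 / 2 :> R)%R by field.
apply: le_trans; rewrite le_eqVlt; apply/orP; left; apply/eqP.
by apply: eq_integral => w _; rewrite /V; congr (expR _)%:E; field.
Qed.

End hoeffding.

(** Independence identifies the law of the pair with the product of the laws; Tonelli's theorem then
    factors the integral. *)
Lemma independent_integralM d (Om : measurableType d) (R : realType)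
    (P : probability Om R) (F G : Om -> R) :
  measurable_fun setT F -> measurable_fun setT G ->
  (forall A B : set R, measurable A -> measurable B ->
    P (F @^-1` A `&` G @^-1` B) = P (F @^-1` A) * P (G @^-1` B))%E ->
  (forall w, 0 <= F w) -> (forall w, 0 <= G w) ->
  (\int[P]_w (F w * G w)%:E = \int[P]_w (F w)%:E * \int[P]_w (G w)%:E)%E.
Proof.
move=> mF mG indep F0 G0.
have mFG : measurable_fun setT (fun w => (F w, G w)).
  exact: measurable_fun_pair.
pose F' : {mfun Om >-> R} := HB.pack F (isMeasurableFun.Build _ _ _ _ F mF).
pose G' : {mfun Om >-> R} := HB.pack G (isMeasurableFun.Build _ _ _ _ G mG).
pose FG : {mfun Om >-> (R * R)%type} :=
  HB.pack (fun w => (F w, G w)) (isMeasurableFun.Build _ _ _ _ _ mFG).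
have prodE := @product_measure_unique _ _ _ _ _ (distribution P F')
  (distribution P G') (distribution P FG) indep.
(* The absolute values make the integrand nonnegative on the whole plane and change nothing on the
   values of [F] and [G]. *)
pose f (z : R * R) : \bar R := (`|z.1| * `|z.2|)%:E.
have mf : measurable_fun setT f.
  by apply/measurable_EFinP; apply: measurable_funM; apply: measurableT_comp.
have f0 z : (0 <= f z)%E by rewrite lee_fin mulr_ge0.
transitivity (\int[distribution P FG]_z f z)%E.
  rewrite ge0_integral_distribution//.
  by apply: eq_integral => w _; rewrite /f/= !ger0_norm.
transitivity (\int[distribution P F' \x distribution P G']_z f z)%E.
  by apply: eq_measure_integral => A mA _; exact/esym/prodE.
rewrite fubini_tonelli1// /fubini_F.
have mn : measurable_fun setT (fun y : R => `|y|%:E).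
  by apply/measurable_EFinP; exact: normr_measurable.
have cG : (\int[distribution P G']_y `|y|%:E = \int[P]_w (G w)%:E)%E.
  rewrite ge0_integral_distribution//; apply: eq_integral => w _.
  by rewrite /= ger0_norm.
under eq_integral.
  move=> x _; rewrite /f/=; under eq_integral do rewrite EFinM.
  rewrite ge0_integralZl// cG muleC; over.
rewrite ge0_integralZl//; last by apply: integral_ge0 => w _; rewrite lee_fin.
rewrite muleC; congr (_ * _)%E; rewrite ge0_integral_distribution//.
by apply: eq_integral => w _; rewrite /= ger0_norm.
Qed.

(** * The past and its independence of the current round *)

Section past.
Context d (Om : measurableType d) (R : realType) (P : probability Om R)
  dU (U : measurableType dU) (K T : nat)
  (seed : Om -> U) (X : 'I_K -> nat -> Om -> R).
Hypothesis mseed : measurable_fun setT seed.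
Hypothesis mX : forall k t, measurable_fun setT (X k t).

Let sigma := @round_sigma R d Om dU U K T seed X.

Let sigma_setT j : sigma j setT.
Proof.
case: j => [t|]; last by exists setT => //; rewrite setTI preimage_setT.
rewrite /sigma/= /g_sigma_preimage.
exact: (@measurableT _ (g_sigma_algebraType _)).
Qed.

Let sigma_setI j A B : sigma j A -> sigma j B -> sigma j (A `&` B).
Proof.
case: j => [t|]; last first.
  move=> [A' mA <-] [B' mB <-]; exists (A' `&` B'); first exact: measurableI.
  by rewrite !setTI preimage_setI.
rewrite /sigma/= /g_sigma_preimage => mA mB.
exact: (@measurableI _ (g_sigma_algebraType _) _ _ mA mB).
Qed.

Lemma round_sigma_sub k (t : 'I_T) (B : set R) : measurable B ->
  sigma (Some t) (X k t @^-1` B).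
Proof.
move=> mB; apply: sub_sigma_algebra.
rewrite -bigcup_seq/=; exists k => /=; first by rewrite mem_index_enum.
by exists B => //; rewrite setTI.
Qed.

Lemma round_sigma_measurable j A : sigma j A -> measurable A.
Proof.
case: j => [t|]; last by move=> [B mB <-]; exact: mseed.
apply: smallest_sub; first exact: sigma_algebra_measurable.
rewrite -bigcup_seq => B [k _ [C mC <-]]; exact: mX.
Qed.

Definition before (t : nat) (j : option 'I_T) : bool :=
  if j is Some s then (s < t)%N else true.

(** A pi-system generating the sigma-algebra of the seed and the rounds before [t]: intersections of
    one event per source. *)
Definition past (t : nat) : set (set Om) :=
  [set A | exists2 E : option 'I_T -> set Om, forall j, sigma j (E j) &
    A = \bigcap_(j in [set` [set j | before t j]%SET]) E j].

Lemma past_sub t j A : before t j -> sigma j A -> past t A.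
Proof.
move=> bj sA; exists (fun i => if i == j then A else setT).
  by move=> i; case: eqP => [->|].
apply/seteqP; split=> [w Aw i _|w /(_ j)]; first by case: ifP.
by rewrite eqxx; apply; rewrite /= inE.
Qed.

Lemma measurable_past_seed t :
  measurable_fun (setT : set (g_sigma_algebraType (past t))) seed.
Proof.
move=> _ B mB; apply: sub_sigma_algebra; apply: (@past_sub t None) => //.
by exists B.
Qed.

Lemma measurable_past_reward t k s : (t <= T)%N -> (s < t)%N ->
  measurable_fun (setT : set (g_sigma_algebraType (past t))) (X k s).
Proof.
move=> tT st _ B mB; apply: sub_sigma_algebra; rewrite setTI.
have sT : (s < T)%N by exact: leq_trans tT.
apply: (@past_sub t (Some (Ordinal sT))) => //.
exact: (@round_sigma_sub k (Ordinal sT)).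
Qed.

Lemma past_measurable t A : <<s past t >> A -> measurable A.
Proof.
apply: smallest_sub; first exact: sigma_algebra_measurable.
move=> _ [E sE ->]; apply: fin_bigcap_measurable => // j _.
exact: (round_sigma_measurable (sE j)).
Qed.

Hypothesis indep : mutually_independent P sigma.

(** Both sides are finite measures in [A]; they agree on the pi-system [past t], hence on the
    sigma-algebra it generates. *)
Lemma past_independent (t : 'I_T) A B : <<s past t >> A -> sigma (Some t) B ->
  (P (A `&` B) = P A * P B)%E.
Proof.
move=> pA sB; have mB := round_sigma_measurable sB.
have PB0 : 0 <= fine (P B) by rewrite fine_ge0.
pose m2 := mscale (NngNum PB0) P.
have m2E C : m2 C = (P C * P B)%E.
  by rewrite /m2 /mscale/= fineK ?fin_num_measure// muleC.
rewrite -m2E.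
rewrite -[LHS]/(mrestr P mB A).
apply: (g_sigma_algebra_measure_unique (past t) _ (fun _ => setT)) pA => //.
- by move=> C pC; apply: (@past_measurable t); exact: sub_sigma_algebra.
- by move=> _; exact: (@past_sub t None).
- by rewrite bigcup_const.
- move=> _ _ [E sE ->] [F sF ->]; exists (fun j => E j `&` F j).
    by move=> j; exact: sigma_setI.
  by rewrite bigcapI.
- move=> _ [E sE ->]; rewrite -[RHS]/(m2 _) m2E -[LHS]/(P (_ `&` B)).
  (* [B] becomes the event of round [t] in the family. Mutual independence is then used twice, for
     the indices before [t] with and without [t] added. *)
  pose E' j := if j == Some t then B else E j.
  have tb : Some t \notin [set j | before t j]%SET by rewrite inE/= ltnn.
  have EE' j : j \in [set j | before t j]%SET -> E j = E' j.
    by rewrite /E'; case: eqP => // ->; rewrite (negbTE tb).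
  have sE' j : sigma j (E' j) by rewrite /E'; case: eqP => // ->.
  rewrite (eq_bigcapr (G := E')); last by move=> j /= /EE'.
  have -> : \bigcap_(j in [set` [set j | before t j]%SET]) E' j `&` B =
      \bigcap_(j in [set` (Some t |: [set j | before t j])%SET]) E' j.
    apply/seteqP; split=> [w [h Bw] j /=|w h].
      rewrite !inE => /orP[/eqP->|bj]; first by rewrite /E' eqxx.
      by apply: h; rewrite /= inE.
    split=> [j /= bj|]; first by apply: h; rewrite /= inE bj orbT.
    by have := h (Some t); rewrite /E' eqxx; apply; rewrite /= !inE eqxx.
  rewrite (indep (fun j _ => sE' j)) big_setU1//= (indep (fun j _ => sE' j)).
  by rewrite muleC; congr (_ * P _)%E; rewrite /E' eqxx.
- move=> _; rewrite -[X in (X < _)%E]/(P (_ `&` B)) setTI.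
  by rewrite (le_lt_trans (probability_le1 P mB))// ltry.
Qed.

End past.

(** * The exponential supermartingale *)

(** Expands a quantity depending on a random history into a finite sum over deterministic histories,
    weighted by indicators. *)
Lemma sum_tuple_pick (R : nzRingType) (I : finType) (n : nat) (s : seq I)
    (z : seq I -> R) : size s = n ->
  \sum_(a : n.-tuple I) (s == a :> seq I)%:R * z a = z s.
Proof.
move=> /eqP sn; rewrite (bigD1 (Tuple sn))//= eqxx mul1r big1 ?addr0// => a an.
rewrite (_ : (s == a :> seq I) = false) ?mul0r//.
by apply: contraNF an => /eqP sa; apply/eqP/val_inj.
Qed.

(** The quantification over all measurable spaces allows an instance at the sigma-algebra of the
    past. *)
Definition measurable_learner (R : realType) (K : nat)
    (learner : seq (observation R K) -> 'I_K) : Prop :=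
  forall d (Om : measurableType d) (o : seq ('I_K * (Om -> R))),
  (forall i k, measurable_fun setT (nth (k, cst 0) o i).2) ->
  finitely_measurable (fun w => learner [seq (p.1, p.2 w) | p <- o]).

Section exponential_supermartingale.
Context d (Om : measurableType d) (R : realType) (P : probability Om R)
  dU (U : measurableType dU) (K T : nat)
  (seed : Om -> U) (X : 'I_K -> nat -> Om -> R)
  (pol : attack_policy R K U) (learner : seq (observation R K) -> 'I_K).
Hypothesis mseed : measurable_fun setT seed.
Hypothesis mX : forall k t, measurable_fun setT (X k t).
Hypothesis indep : mutually_independent P (@round_sigma R d Om dU U K T seed X).
Hypothesis mpol : measurable_policy pol.
Hypothesis mlearner : measurable_learner learner.

Let hist w t := arms pol learner seed X w t.

(** The sigma-algebra that [round_sigma] attaches to round [t], in the form of a measurable type. *)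
Definition round_space (t : nat) := g_sigma_algebraType
  (\big[setU/set0]_(k < K) preimage_set_system setT (X k t) measurable).

Lemma measurable_round_reward t k :
  measurable_fun (setT : set (round_space t)) (X k t).
Proof.
move=> _ B mB; apply: sub_sigma_algebra.
by rewrite -bigcup_seq/=; exists k => /=; [rewrite mem_index_enum|exists B].
Qed.

Section process.
(** [y t a] is the log-increment of round [t] if [a] lists the arms pulled up to and including that
    round; for fixed [a] it depends on the rewards of round [t] alone. *)
Variable y : nat -> seq 'I_K -> Om -> R.
Hypothesis my : forall t a, (t < T)%N ->
  measurable_fun (setT : set (round_space t)) (y t a).
Hypothesis y_le1 : forall t a, (t < T)%N ->
  (\int[P]_w (expR (y t a w))%:E <= 1)%E.

Let S n w := \sum_(t < n) y t (hist w t.+1) w.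

Let past_hist n : (n <= T)%N -> forall t, (t <= n)%N ->
  @finitely_measurable _ (g_sigma_algebraType (past T seed X n)) _
    (fun w => hist w t.+1).
Proof.
move=> nT t tn; apply: finitely_measurable_arms => //.
- exact: measurable_past_seed.
- by move=> o mo; exact: mlearner.
- move=> k s st; apply: measurable_past_reward => //.
  exact: leq_trans tn.
Qed.

Let past_S n : (n <= T)%N ->
  measurable_fun (setT : set (g_sigma_algebraType (past T seed X n))) (S n).
Proof.
move=> nT; apply: measurable_sum => t.
apply: (@measurable_fun_finitely_measurable_bind _
  (g_sigma_algebraType (past T seed X n)) _ _ _ (fun w => hist w t.+1) (y t)).
  exact: past_hist (ltnW (ltn_ord t)).
move=> a _ _ B mB; apply: sub_sigma_algebra.
have tT : (t < T)%N by exact: leq_trans nT.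
apply: (@past_sub _ _ _ _ _ _ _ _ _ _ (Some (Ordinal tT))) => /=.
  exact: ltn_ord.
exact: my.
Qed.

Let sub_measurable d' (V : measurableType d') n (f : Om -> V) :
  measurable_fun (setT : set (g_sigma_algebraType (past T seed X n))) f ->
  measurable_fun setT f.
Proof.
by move=> mf _ B mB; apply: (past_measurable mseed mX); exact: mf.
Qed.

Let my' t a : (t < T)%N -> measurable_fun (setT : set Om) (y t a).
Proof.
move=> tT _ B mB.
apply: (round_sigma_measurable (T := T) mseed mX (j := Some (Ordinal tT))).
exact: (@my t a tT measurableT).
Qed.

Lemma measurable_process n : (n <= T)%N -> measurable_fun setT (S n).
Proof. by move=> nT; exact: (sub_measurable (past_S nT)). Qed.

(** On each history [a] of [n.+1] arms the new factor [expR (y n a w)] is independent of the past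
    weight [F a] and has mean at most 1. Summing over [a] replaces conditional expectation. *)
Lemma exp_supermartingale n : (n <= T)%N ->
  (\int[P]_w (expR (S n w))%:E <= 1)%E.
Proof.
elim: n => [|n IH] nT.
  rewrite /S; under eq_integral do rewrite big_ord0 expR0.
  by rewrite integral_cst//= mul1e probability_setT.
apply: le_trans (IH (ltnW nT)).
pose F (a : n.+1.-tuple 'I_K) w : R :=
  (hist w n.+1 == a :> seq _)%:R * expR (S n w).
have pF a : measurable_fun
    (setT : set (g_sigma_algebraType (past T seed X n))) (F a).
  apply: (@measurable_fun_finitely_measurable_bind _
    (g_sigma_algebraType (past T seed X n)) _ _ _ (fun w => hist w n.+1)
    (fun b w => (b == a :> seq _)%:R * expR (S n w))).
    exact: (past_hist (ltnW nT) (leqnn n)).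
  move=> b _; apply: measurable_funM => //.
  by apply: measurableT_comp => //; exact: past_S (ltnW nT).
have F0 a w : 0 <= F a w by rewrite mulr_ge0// expR_ge0.
have mE a : measurable_fun (setT : set Om) (fun w => expR (y n a w)).
  by apply: measurableT_comp => //; exact: my'.
have E0 a w : 0 <= expR (y n a w) by exact: expR_ge0.
have -> : (\int[P]_w (expR (S n.+1 w))%:E =
    \int[P]_w \sum_(a : n.+1.-tuple 'I_K) (F a w * expR (y n a w))%:E)%E.
  apply: eq_integral => w _; rewrite sumEFin; congr _%:E.
  have -> : S n.+1 w = S n w + y n (hist w n.+1) w by rewrite /S big_ord_recr.
  rewrite -(sum_tuple_pick (n := n.+1) (fun a => expR (S n w + y n a w)))//.
    by apply: eq_bigr => a _; rewrite /F -mulrA expRD.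
  exact: size_arms.
have -> : (\int[P]_w (expR (S n w))%:E =
    \int[P]_w \sum_(a : n.+1.-tuple 'I_K) (F a w)%:E)%E.
  apply: eq_integral => w _; rewrite sumEFin; congr _%:E.
  exact/esym/(sum_tuple_pick (fun=> expR (S n w))
    (size_arms pol learner seed X w n.+1)).
rewrite ge0_integral_sum//; last 2 first.
- move=> a; apply/measurable_EFinP; apply: measurable_funM => //.
  exact: sub_measurable (pF a).
- by move=> a w _; rewrite lee_fin mulr_ge0.
rewrite ge0_integral_sum//; last 2 first.
- by move=> a; apply/measurable_EFinP; exact: sub_measurable (pF a).
- by move=> a w _; rewrite lee_fin.
apply: lee_sum => a _.
rewrite (independent_integralM (F := F a) (sub_measurable (pF a)) (mE a))//.
  rewrite -[leRHS]mule1 lee_wpmul2l ?y_le1//.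
  by apply: integral_ge0 => w _; rewrite lee_fin.
move=> A B mA mB.
apply: (past_independent mseed mX indep (t := Ordinal nT)).
  by have := pF a measurableT A mA; rewrite setTI.
have mr : measurable_fun (setT : set (round_space n)) (fun w => expR (y n a w)).
  by apply: measurableT_comp => //; exact: my.
by have := mr measurableT B mB; rewrite setTI.
Qed.

(** Chernoff's bound with parameter 1, since the scale is already inside [y]. *)
Lemma exp_supermartingale_tail (b : R) :
  (P [set w | (b <= S T w)%R] <= (expR (- b))%:E)%E.
Proof.
have mS := measurable_process (leqnn T).
pose S' : {mfun Om >-> R} :=
  HB.pack (S T) (isMeasurableFun.Build _ _ _ _ (S T) mS).
have := @chernoff _ _ _ P S' 1 b ltr01.
rewrite mul1r => /le_trans; apply.
rewrite -[leRHS]mul1e lee_pmul2r ?lte_fin ?expR_gt0//.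
rewrite /mmt_gen_fun unlock; apply: le_trans (exp_supermartingale (leqnn T)).
by under eq_integral do rewrite /= mulr1.
Qed.

End process.
End exponential_supermartingale.

(** * Regret on one sample path *)

(* Log-increments of the exponential martingales. The list a holds the arms
   pulled so far, the arm of round t at its head. *)
Definition pull_increment (R : realType) (K : nat) (mu : 'I_K -> R)
    (k : 'I_K) (n : nat) (lam : R) (x : 'I_K -> nat -> R)
    (t : nat) (a : seq 'I_K) : R :=
  if a is i :: a' then
    if (i == k) && (count_mem k a' < n)%N
    then lam * (x k t - mu k) - lam ^+ 2 / 8 else 0
  else 0.

(** A difference of two rewards has range 2, whence [lam ^+ 2 / 2] instead of [lam ^+ 2 / 8]. Rounds
    pulling [k] cost nothing, so only the other rounds are charged. *)
Definition diff_increment (R : realType) (K : nat) (mu : 'I_K -> R)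
    (k : 'I_K) (lam : R) (x : 'I_K -> nat -> R)
    (t : nat) (a : seq 'I_K) : R :=
  if a is i :: a' then
    if i == k then 0
    else lam * (x k t - mu k - (x i t - mu i)) - lam ^+ 2 / 2
  else 0.

Section sample_path.
Variables (R : realType) (K T : nat) (C delta : R) (order : pull_order K).
Variables (k0 kstar : 'I_K) (mu : 'I_K -> R).
Variables (U : Type) (pol : attack_policy R K U) (u : U) (x : 'I_K -> nat -> R).

Let learner := sewr T C delta order k0.
Let tr t := transcript learner pol u x t.
Let I t := pulled learner pol u x t.
Let hist t : seq 'I_K := map fst (tr t).
Let h t : seq (observation R K) := map (@observed R K) (tr t).
Let gap k := mu kstar - mu k.
Let L := ln (2 * K%:R * T%:R / delta).

Let trS t :
  tr t.+1 = (I t, (x (I t) t, pol u (tr t) (I t) (x (I t) t))) :: tr t.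
Proof. by []. Qed.

Let num_pulls_hist t k : num_pulls (h t) k = count_mem k (hist t).
Proof. by rewrite /num_pulls /h /hist !count_map. Qed.

Let num_pullsS t k : num_pulls (h t.+1) k = ((I t == k) + num_pulls (h t) k)%N.
Proof. by []. Qed.

Let num_pulls_mono s t k : (s <= t)%N ->
  (num_pulls (h s) k <= num_pulls (h t) k)%N.
Proof.
move=> /subnKC <-; elim: (t - s)%N => [|m IH]; first by rewrite addn0.
by rewrite addnS num_pullsS (leq_trans IH)// leq_addl.
Qed.

Let num_pulls_le t k : (num_pulls (h t) k <= t)%N.
Proof.
elim: t => [//|t IH]; rewrite num_pullsS.
by case: (_ == k); rewrite ?add1n ?add0n// leqW.
Qed.

(** The cutoff after [n] pulls silences every round from [t] on. A deterministic [n] thus handles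
    the random time of the [n]-th pull, and a union over [n] covers all times. *)
Lemma sum_pull_increment k lam t : (t <= T)%N ->
  \sum_(s < T) pull_increment mu k (num_pulls (h t) k) lam x s (hist s.+1) =
  lam * \sum_(e <- tr t | e.1 == k) (e.2.1 - mu k)
    - lam ^+ 2 / 8 * (num_pulls (h t) k)%:R.
Proof.
move=> tT; set n := num_pulls (h t) k.
rewrite -(big_mkord xpredT
  (fun s => pull_increment mu k n lam x s (hist s.+1))).
rewrite (big_cat_nat (leq0n t) tT)//= [X in _ + X]big_nat_cond.
rewrite [X in _ + X]big1; last first.
  move=> s /andP[/andP[ts _] _]; rewrite -num_pulls_hist.
  by rewrite ltnNge num_pulls_mono// andbF.
rewrite addr0.
have : forall s, (s < t)%N -> I s == k -> (num_pulls (h s) k < n)%N.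
  move=> s st Is; apply: leq_trans (num_pulls_mono k st).
  by rewrite num_pullsS Is.
rewrite [X in _ - _ * X%:R](_ : _ = num_pulls (h t) k)//; move: n => n.
elim: t {tT} => [|t IH] sn; first by rewrite big_nil big_nil !mulr0 subrr.
rewrite big_nat_recr//= IH; last by move=> s st; apply: sn; rewrite ltnW.
rewrite -/(tr t) -/(h t) -/(hist t) -num_pulls_hist trS big_cons/=.
rewrite -[learner _]/(I t); have := sn _ (leqnn t.+1).
case: (eqVneq (I t) k) => [->|_] /= snt.
  by rewrite snt// natrD; ring.
by rewrite addr0 add0n.
Qed.

Let sum_tr_pull (f : 'I_K -> R) t :
  \sum_(s < t) f (I s) = \sum_k f k * (num_pulls (h t) k)%:R.
Proof.
elim: t => [|t IH]; first by rewrite big_ord0 big1// => k _; rewrite mulr0.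
under [RHS]eq_bigr do rewrite num_pullsS natrD mulrDr.
rewrite big_ord_recr big_split/= IH addrC; congr (_ + _).
rewrite (bigD1 (I t))//= eqxx mulr1 big1 ?addr0// => k /negbTE kI.
by rewrite eq_sym kI mulr0.
Qed.

Hypotheses (C0 : 0 <= C) (L1 : 1 <= L) (order_valid : valid_pull_order order).
Hypothesis kstar_best : forall k, k != kstar -> mu k < mu kstar.
Hypothesis mu01 : forall k, 0 <= mu k <= 1.
Hypothesis attack : total_attack learner pol u x T <= C.
Hypothesis deviation : forall k n (b : bool), (0 < n)%N -> (n <= T)%N ->
  \sum_(s < T) pull_increment mu k n ((-1) ^+ b * (4 * Num.sqrt (L / n%:R))) x s
    (hist s.+1) <= 2 * L.

Let attack_le t : (t <= T)%N -> \sum_(e <- tr t) `|e.2.1 - e.2.2| <= C.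
Proof.
move=> tT; apply: le_trans attack; rewrite /total_attack -/(tr T).
rewrite -(subnKC tT); elim: (T - t)%N => [|m IH]; first by rewrite addn0.
by rewrite addnS trS big_cons (le_trans IH)// lerDr.
Qed.

Let concentrated t k : (t <= T)%N -> (0 < num_pulls (h t) k)%N ->
  `|emp_mean (h t) k - mu k| <= wide_radius K T C delta (num_pulls (h t) k).
Proof.
move=> tT n0; have nT := leq_trans (num_pulls_le t k) tT.
have dev := deviation k _ n0 nT; move: n0.
have {dev} := (dev false, dev true); rewrite !sum_pull_increment//.
rewrite expr0 expr1 mul1r mulN1r sqrrN.
have cntE : (num_pulls (h t) k)%:R = \sum_(e <- tr t | e.1 == k) 1 :> R.
  rewrite big_const_seq iter_addr addr0 -mulr_natr mul1r.
  by rewrite /num_pulls /h count_map.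
rewrite /emp_mean /h big_map/= -/(h t) /wide_radius -/L.
set n := num_pulls _ k => dev n0; set r := Num.sqrt _ in dev *.
have n0' : 0 < n%:R :> R by rewrite ltr0n.
have r0 : 0 < r by rewrite sqrtr_gt0 divr_gt0// (lt_le_trans ltr01).
have r2 : r ^+ 2 * n%:R = L.
  by rewrite sqr_sqrtr ?divfK ?gt_eqF// divr_ge0 ?ltW// (lt_le_trans ltr01).
move: dev; set M := \sum_(e <- _ | _) _ => -[d1 d2].
(* With [lam = 4 * r] up to sign, the quadratic cost [lam ^+ 2 / 8 * n] equals the threshold
   [2 * L]; so [4 * r * M] is at most [4 * L = 4 * r ^+ 2 * n] in absolute value. *)
have M1 : `|M| <= r * n%:R.
  have e : (4 * r) ^+ 2 / 8 * n%:R = 2 * L by rewrite -r2; field.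
  rewrite e in d1 d2; rewrite -r2 in d1 d2.
  by rewrite -(ler_pM2l r0) -[X in X * `|M|]gtr0_norm// -normrM ler_norml; lra.
(* The attacked mean deviates by the raw deviation [M] plus the attack on arm [k], the latter at
   most [C] in total. *)
have -> : (\sum_(e <- tr t | e.1 == k) e.2.2) / n%:R - mu k =
    (M + \sum_(e <- tr t | e.1 == k) (e.2.2 - e.2.1)) / n%:R.
  rewrite -big_split/=.
  have -> : \sum_(e <- tr t | e.1 == k) (e.2.1 - mu k + (e.2.2 - e.2.1)) =
      \sum_(e <- tr t | e.1 == k) (e.2.2 - mu k * 1).
    by apply: eq_bigr => e _; rewrite mulr1; ring.
  by rewrite sumrB -mulr_sumr -cntE; field; rewrite gt_eqF.
rewrite normrM normfV (gtr0_norm n0') ler_pdivrMr// mulrDl divfK ?gt_eqF//.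
apply: le_trans (ler_normD _ _) _; apply: lerD => //.
apply: le_trans (ler_norm_sum _ _ _) (le_trans _ (attack_le tT)).
rewrite big_mkcond/=; apply: ler_sum => e _.
by case: ifP => _; rewrite ?normr_ge0// distrC.
Qed.

(** An arm contributes at most [gap k * (1 + pull_bound k)], that is,
    [gap k + 64 * (L / gap k) + 8 * C]; the first term is at most [L / gap k] because
    [gap k <= 1 <= L]. *)
Lemma pseudo_regret_path_le :
  \sum_(t < T) gap (I t) <=
    65 * (\sum_(k < K | k != kstar) L / gap k) + 8 * (K%:R * C).
Proof.
rewrite sum_tr_pull (bigD1 kstar)//= {1}/gap subrr mul0r add0r.
apply: (@le_trans _ _ (\sum_(k < K | k != kstar) (65 * (L / gap k) + 8 * C))).
  apply: ler_sum => k kk; have g0 : 0 < gap k by rewrite subr_gt0 kstar_best.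
  have hS t : exists r, h t.+1 = (sewr T C delta order k0 (h t), r) :: h t.
    by exists (pol u (tr t) (I t) (x (I t) t)).
  have := num_pulls_bound C0 (le_trans ler01 L1) order_valid kstar_best erefl
    hS concentrated (leqnn T) kk.
  move=> /(ler_wpM2l (ltW g0)) /le_trans; apply.
  have g1 : gap k <= L / gap k.
    rewrite ler_pdivlMr//; apply: le_trans L1.
    by have := mu01 k; have := mu01 kstar; move: g0; rewrite /gap; nra.
  rewrite /pull_bound -/L -/(gap k).
  rewrite [leLHS](_ : _ = gap k + 64 * (L / gap k) + 8 * C); last first.
    by field; rewrite gt_eqF.
  by lra.
rewrite big_split/= -mulr_sumr lerD2l -mulr_sumr sumr_const.
rewrite ler_pM2l// -[leLHS]mulr_natl ler_wpM2r// ler_nat.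
by rewrite (leq_trans (max_card _))// card_ord.
Qed.

Let lam (k1 k : 'I_K) := gap (if k == kstar then k1 else k).

Lemma realized_regret_path_le (k1 : 'I_K) (l : R) : 0 <= l ->
  k1 != kstar -> (forall k, k != kstar -> gap k1 <= gap k) ->
  (forall k, \sum_(s < T) diff_increment mu k
     (gap (if k == kstar then k1 else k)) x s (hist s.+1) <= l) ->
  realized_regret kstar x I T <=
    3 / 2 * (\sum_(t < T) gap (I t)) + \sum_(k < K | k != kstar) l / gap k.
Proof.
move=> l0 k1k mink dev; apply/max_arm_le => k.
have gap0 j : 0 <= gap j.
  by rewrite subr_ge0; have [->//|/kstar_best/ltW] := eqVneq j kstar.
have gapp j : j != kstar -> 0 < gap j by move=> /kstar_best; rewrite subr_gt0.
set k' := if k == kstar then k1 else k.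
have k'k : k' != kstar by rewrite /k'; case: (eqVneq k kstar).
have g0 := gapp _ k'k.
set m : R := \sum_(s < T) (I s != k)%:R.
(* Split into a centered sum, controlled by [dev], and a drift in terms of means. *)
have -> : \sum_(t < T) (x k t - x (I t) t) =
    \sum_(t < T) (x k t - mu k - (x (I t) t - mu (I t))) +
    \sum_(t < T) (mu k - mu (I t)).
  by rewrite -big_split/=; apply: eq_bigr => t _; ring.
set D := \sum_(t < T) (x k t - mu k - _).
have devE : gap k' * D - gap k' ^+ 2 / 2 * m <= l.
  apply: le_trans (dev k); rewrite le_eqVlt; apply/orP; left; apply/eqP.
  rewrite !mulr_sumr -sumrB; apply: eq_bigr => t _; rewrite /diff_increment/=.
  rewrite -/(I t); case: eqVneq => [->|_]; first by rewrite subrr !mulr0 subrr.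
  by rewrite mulr1.
have Dle : D <= l / gap k' + gap k' / 2 * m.
  have -> : l / gap k' + gap k' / 2 * m = (l + gap k' ^+ 2 / 2 * m) / gap k'.
    by field; rewrite gt_eqF.
  by rewrite ler_pdivlMr// mulrC -lerBlDr.
have lle : l / gap k' <= \sum_(j < K | j != kstar) l / gap j.
  rewrite (bigD1 k')//= lerDl; apply: sumr_ge0 => j _; exact: divr_ge0.
set pr := \sum_(t < T) gap (I t).
suff : gap k' / 2 * m + \sum_(t < T) (mu k - mu (I t)) <= 3 / 2 * pr by lra.
(* For the best arm, every suboptimal pull adds [gap k1 / 2], at most half its own gap: hence the
   factor 3 / 2. *)
have [kk|kk] := eqVneq k kstar.
  have -> : \sum_(t < T) (mu k - mu (I t)) = pr by rewrite kk.
  suff : gap k' * m <= pr by lra.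
  rewrite mulr_sumr; apply: ler_sum => t _; rewrite kk.
  have [->|It] := eqVneq (I t) kstar; first by rewrite mulr0.
  by rewrite mulr1 /k' kk eqxx mink.
(* For another arm, the drift [- gap k * T] outweighs the quadratic term, which is at most half of
   it in size. *)
have -> : \sum_(t < T) (mu k - mu (I t)) = pr - gap k * T%:R.
  rewrite -[in RHS](card_ord T) mulr_natr -sumr_const -sumrB.
  by apply: eq_bigr => t _; rewrite /gap; ring.
have mT : m <= T%:R.
  rewrite -[in leRHS](card_ord T) -sumr_const.
  by apply: ler_sum => t _; case: (_ != k); rewrite ?lexx ?ler01.
have pr0 : 0 <= pr by exact: sumr_ge0.
have k'E : k' = k by rewrite /k' (negbTE kk).
have := ler_wpM2l (gap0 k) mT; have := mulr_ge0 (gap0 k) (ler0n R T).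
by rewrite k'E; lra.
Qed.

End sample_path.

(** * Deviation events *)

Section arm_law.
Context d (Om : measurableType d) (R : realType) (P : probability Om R).
Variables (K : nat) (nu : 'I_K -> probability R R).
Hypothesis nu01 : unit_supported nu.
Local Open Scope ereal_scope.

Definition has_law (X : {RV P >-> R}) (k : 'I_K) : Prop :=
  forall B : set R, measurable B -> distribution P X B = nu k B.

Let nu_out k : nu k (~` `[0%R, 1%R]) = 0.
Proof. by rewrite probability_setC// nu01 subee. Qed.

Lemma ae_clip (X : {RV P >-> R}) k : has_law X k ->
  {ae P, forall w, clip (X w) = X w}.
Proof.
move=> Xk; exists (X @^-1` (~` `[0%R, 1%R])); split.
- rewrite -[X in measurable X]setTI; apply: measurable_funP => //.
  exact: measurableC.
- by have := Xk _ (measurableC (measurable_itv `[0%R, 1%R])); rewrite nu_out.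
- move=> w /= h X01; apply: h; apply: clip_id.
  by move: X01; rewrite /= in_itv.
Qed.

Lemma integral_clip (X : {RV P >-> R}) k : has_law X k ->
  \int[P]_w (clip (X w))%:E = (arm_mean nu k)%:E.
Proof.
move=> Xk.
have mc : measurable_fun setT (fun y : R => (clip y)%:E).
  by apply/measurable_EFinP; exact: measurable_clip.
have c0 (y : R) : 0 <= (clip y)%:E by rewrite lee_fin; case/andP: (clip01 y).
have -> : \int[P]_w (clip (X w))%:E = \int[nu k]_y (clip y)%:E.
  rewrite -(ge0_integral_distribution X mc c0).
  by apply: eq_measure_integral => A mA _; exact: Xk.
have -> : arm_mean nu k = fine (\int[nu k]_y (clip y)%:E).
  rewrite /arm_mean /Rintegral; congr fine; apply: ae_eq_integral => //.
  exists (~` `[0%R, 1%R]); split; [exact: measurableC|exact: nu_out|].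
  by move=> y /= h y01; apply: h => _; rewrite clip_id.
rewrite fineK// ge0_fin_numE; last exact: integral_ge0.
apply: (@le_lt_trans _ _ (\int[nu k]_y 1)).
  by apply: ge0_le_integral => // y _; rewrite lee_fin; case/andP: (clip01 y).
by rewrite integral_cst//= mul1e probability_setT ltry.
Qed.

Let measurable_clip_comp (X : {RV P >-> R}) :
  measurable_fun setT (fun w => clip (X w)).
Proof.
by apply: (measurableT_comp (f := @clip R)) => //; exact: measurable_clip.
Qed.

Lemma arm_mean01 (X : {RV P >-> R}) k : has_law X k ->
  (0 <= arm_mean nu k <= 1)%R.
Proof.
move=> Xk; apply: mean01 (integral_clip Xk) => //.
by move=> w; exact: clip01.
Qed.

(** Hoeffding's lemma for the clipped reward, which has the same mean and equals the reward almost
    everywhere. *)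
Lemma hoeffding_arm (X : {RV P >-> R}) k x : has_law X k ->
  \int[P]_w (expR (x * (X w - arm_mean nu k)))%:E <= (expR (x ^+ 2 / 8))%:E.
Proof.
move=> Xk; have c01 w := clip01 (X w).
apply: le_trans
  (hoeffding_unit x (measurable_clip_comp X) c01 (integral_clip Xk)).
rewrite le_eqVlt; apply/orP; left; apply/eqP; apply: ae_eq_integral => //.
- apply/measurable_EFinP; apply: measurableT_comp => //.
  apply: measurable_funM => //; exact: measurable_funB.
- apply/measurable_EFinP; apply: measurableT_comp => //.
  apply: measurable_funM => //; exact: measurable_funB.
- by apply: filterS (ae_clip Xk) => w -> _.
Qed.

Lemma hoeffding_arms (X Y : {RV P >-> R}) k j x : has_law X k -> has_law Y j ->
  \int[P]_w (expR (x * (X w - arm_mean nu k - (Y w - arm_mean nu j))))%:E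
    <= (expR (x ^+ 2 / 2))%:E.
Proof.
move=> Xk Yj; have cX w := clip01 (X w); have cY w := clip01 (Y w).
apply: le_trans (hoeffding_diff x (measurable_clip_comp X) cX (integral_clip Xk)
  (measurable_clip_comp Y) cY (integral_clip Yj)).
rewrite le_eqVlt; apply/orP; left; apply/eqP; apply: ae_eq_integral => //.
- apply/measurable_EFinP; apply: measurableT_comp => //.
  apply: measurable_funM => //.
  by apply: measurable_funB; exact: measurable_funB.
- apply/measurable_EFinP; apply: measurableT_comp => //.
  apply: measurable_funM => //.
  by apply: measurable_funB; exact: measurable_funB.
- by apply: filterS2 (ae_clip Xk) (ae_clip Yj) => w -> -> _.
Qed.

End arm_law.

Lemma probability_bigsetU_le d (Om : measurableType d) (R : realType)
    (P : probability Om R) (J : Type) (s : seq J) (A : J -> set Om) (a : R) :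
  (forall j, measurable (A j)) -> (forall j, P (A j) <= a%:E)%E ->
  (P (\big[setU/set0]_(j <- s) A j) <= (a *+ size s)%:E)%E.
Proof.
move=> mA PA; elim: s => [|j s IH]; first by rewrite big_nil measure0 mulr0n.
rewrite big_cons/= mulrS EFinD; apply: le_trans (leeD (PA j) IH).
by apply: measureU2 => //; exact: bigsetU_measurable.
Qed.

Section deviation_events.
Context d (Om : measurableType d) (R : realType) (P : probability Om R)
  dU (U : measurableType dU) (K T : nat) (nu : 'I_K -> probability R R)
  (seed : Om -> U) (X : 'I_K -> nat -> {RV P >-> R})
  (pol : attack_policy R K U) (learner : seq (observation R K) -> 'I_K).
Hypothesis mseed : measurable_fun setT seed.
Hypothesis mpol : measurable_policy pol.
Hypothesis mlearner : measurable_learner learner.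
Hypothesis nu01 : unit_supported nu.
Hypothesis rewards : bandit_rewards T nu seed X.

Let mu := arm_mean nu.
Let hist w t := arms pol learner seed (fun k t w => X k t w) w t.
Let x w k t : R := X k t w.
Let law k t : (t < T)%N -> has_law nu (X k t) k.
Proof. by case: rewards => h _ tT B mB; exact: h. Qed.

Let mX k t : measurable_fun setT (X k t : Om -> R).
Proof. by []. Qed.

Let mround t k := @measurable_round_reward d Om R K (fun k t w => X k t w) t k.

Let measurable_pull_increment k n lam t a :
  measurable_fun (setT : set (round_space (fun k t w => X k t w) t))
    (fun w => pull_increment mu k n lam (x w) t a).
Proof.
case: a => [//|i a]; rewrite /pull_increment; case: (_ && _) => //.
apply: measurable_funB => //; apply: measurable_funM => //.
by apply: measurable_funB => //; exact: mround.
Qed.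

Let measurable_diff_increment k lam t a :
  measurable_fun (setT : set (round_space (fun k t w => X k t w) t))
    (fun w => diff_increment mu k lam (x w) t a).
Proof.
case: a => [//|i a]; rewrite /diff_increment; case: (i == k) => //.
apply: measurable_funB => //; apply: measurable_funM => //.
by apply: measurable_funB; apply: measurable_funB => //; exact: mround.
Qed.

Let int_exp0 : (\int[P]_w (expR (cst 0 w))%:E <= 1)%E.
Proof.
under eq_integral do rewrite expR0.
by rewrite integral_cst//= mul1e probability_setT.
Qed.

Let int_expB (f : Om -> R) (b : R) : measurable_fun setT f ->
  (\int[P]_w (expR (f w))%:E <= (expR b)%:E)%E ->
  (\int[P]_w (expR (f w - b))%:E <= 1)%E.
Proof.
move=> mf fb; under eq_integral do rewrite expRD EFinM muleC.
rewrite ge0_integralZl//=; last first.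
  by apply/measurable_EFinP; exact: measurableT_comp.
apply: (@le_trans _ _ ((expR (- b))%:E * (expR b)%:E)%E); last first.
  by rewrite -EFinM -expRD addNr expR0.
by rewrite lee_pmul2l// lte_fin expR_gt0.
Qed.

Let pull_increment_le1 k n lam t a : (t < T)%N ->
  (\int[P]_w (expR (pull_increment mu k n lam (x w) t a))%:E <= 1)%E.
Proof.
move=> tT; case: a => [//|i a]; rewrite /pull_increment; case: (_ && _) => //.
apply: int_expB; last exact: hoeffding_arm nu01 _ _ _ (law _ tT).
by apply: measurable_funM => //; exact: measurable_funB.
Qed.

Let diff_increment_le1 k lam t a : (t < T)%N ->
  (\int[P]_w (expR (diff_increment mu k lam (x w) t a))%:E <= 1)%E.
Proof.
move=> tT; case: a => [//|i a]; rewrite /diff_increment; case: (i == k) => //.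
apply: int_expB; last first.
  exact: hoeffding_arms nu01 _ _ _ _ _ (law _ tT) (law _ tT).
apply: measurable_funM => //; apply: measurable_funB; exact: measurable_funB.
Qed.

Definition pull_event k n lam b : set Om := [set w |
  b <= \sum_(t < T) pull_increment mu k n lam (x w) t (hist w t.+1)].

Definition diff_event k lam b : set Om := [set w |
  b <= \sum_(t < T) diff_increment mu k lam (x w) t (hist w t.+1)].

Lemma pull_event_le k n lam b : measurable (pull_event k n lam b) /\
  (P (pull_event k n lam b) <= (expR (- b))%:E)%E.
Proof.
have [_ ind] := rewards.
have my := fun t a (_ : (t < T)%N) => @measurable_pull_increment k n lam t a.
have y1 := fun t a (tT : (t < T)%N) => @pull_increment_le1 k n lam t a tT.
split; last exact: (exp_supermartingale_tail mseed mX ind mpol mlearner my y1).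
have mS := measurable_process mseed mX mpol mlearner my (leqnn T).
have := measurable_fun_ler (measurable_cst b) mS.
by move=> /(_ measurableT [set true] I); rewrite setTI.
Qed.

Lemma diff_event_le k lam b : measurable (diff_event k lam b) /\
  (P (diff_event k lam b) <= (expR (- b))%:E)%E.
Proof.
have [_ ind] := rewards.
have my := fun t a (_ : (t < T)%N) => @measurable_diff_increment k lam t a.
have y1 := fun t a (tT : (t < T)%N) => @diff_increment_le1 k lam t a tT.
split; last exact: (exp_supermartingale_tail mseed mX ind mpol mlearner my y1).
have mS := measurable_process mseed mX mpol mlearner my (leqnn T).
have := measurable_fun_ler (measurable_cst b) mS.
by move=> /(_ measurableT [set true] I); rewrite setTI.
Qed.

End deviation_events.

(** * The two regret bounds *)

Section log_bounds.
Variable R : realType.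

(** From [ln (1 + y) <= y] at [y = - 1 / 2]. *)
Lemma ln2_ge_half : 1 / 2 <= ln 2 :> R.
Proof.
have := @le_ln1Dx R (- 2^-1); have -> : 1 + - 2^-1 = 2^-1 :> R by field.
by rewrite lnV ?posrE//; lra.
Qed.

(** With [a = K * T / delta >= 2], the first logarithm is [ln 2 + ln a], which lies between
    [2 * ln 2 >= 1] and [2 * ln a]; also [2 * K / delta <= 2 * a]. *)
Lemma ln_confidence (K T : nat) (delta : R) : (2 <= K)%N -> (0 < T)%N ->
  0 < delta < 1 ->
  [/\ 1 <= ln (2 * K%:R * T%:R / delta),
      ln (2 * K%:R * T%:R / delta) <= 2 * ln (K%:R * T%:R / delta),
      ln (2 * K%:R / delta) <= 2 * ln (K%:R * T%:R / delta) &
      0 <= ln (2 * K%:R / delta)].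
Proof.
move=> K2 T0 /andP[d0 d1].
have K2' : 2 <= K%:R :> R by rewrite ler_nat.
have T1 : 1 <= T%:R :> R by rewrite ler1n.
set a := K%:R * T%:R / delta.
have Kd : K%:R <= K%:R / delta.
  by rewrite ler_pdivlMr// ler_piMr ?ltW// (lt_le_trans _ K2').
have Ka : K%:R / delta <= a.
  by rewrite /a ler_pM2r ?invr_gt0// ler_peMr// (le_trans _ K2').
have a2 : 2 <= a := le_trans K2' (le_trans Kd Ka).
have -> : 2 * K%:R * T%:R / delta = 2 * a by rewrite /a; field; lra.
have a0 : 0 < a by lra.
have l2 := ln2_ge_half.
have la : ln 2 <= ln a by rewrite ler_ln ?posrE.
have l2a : ln (2 * a) = ln 2 + ln a by rewrite lnM ?posrE.
split; rewrite ?l2a; [lra|lra| |].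
  apply: (@le_trans _ _ (ln (2 * a))); last by rewrite l2a; lra.
  by rewrite ler_ln ?posrE -?mulrA; lra.
by apply: ln_ge0; rewrite -mulrA; lra.
Qed.

End log_bounds.

(** * Exceptional events and assembly of the constants *)

Section main.
Variables (R : realType) (K T : nat) (nu : 'I_K -> probability R R)
  (kstar : 'I_K) (d : measure_display) (Omega : measurableType d)
  (P : probability Omega R) (X : 'I_K -> nat -> {RV P >-> R})
  (dU : measure_display) (U : measurableType dU)
  (seed : {mfun Omega >-> U}) (pol : attack_policy R K U)
  (order : pull_order K) (k0 : 'I_K) (C delta : R).
Hypotheses (K2 : (2 <= K)%N) (T0 : (0 < T)%N) (nu01 : unit_supported nu)
  (best : unique_best_arm nu kstar) (rewards : bandit_rewards T nu seed X)
  (mpol : measurable_policy pol) (order_valid : valid_pull_order order)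
  (C0 : 0 <= C) (delta01 : 0 < delta < 1).

Let learner := sewr T C delta order k0.
Let x (w : Omega) (k : 'I_K) (t : nat) : R := X k t w.
Let I (w : Omega) (t : nat) : 'I_K := pulled learner pol (seed w) (x w) t.
Let mu := arm_mean nu.
Let L := ln (2 * K%:R * T%:R / delta).
Let l := ln (2 * K%:R / delta).

Let mlearner : measurable_learner learner.
Proof. by move=> d' Om o; exact: finitely_measurable_sewr. Qed.

Let mu01 k : 0 <= mu k <= 1.
Proof.
have [law _] := rewards; apply: (arm_mean01 nu01 (X := X k 0%N)) => B mB.
exact: law.
Qed.

Let gap_gt0 k : k != kstar -> 0 < gap nu kstar k.
Proof. by move=> /best; rewrite /gap subr_gt0. Qed.

Let gap_le1 k : gap nu kstar k <= 1.
Proof. by have := mu01 k; have := mu01 kstar; rewrite /gap /mu; lra. Qed.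

Let mseed : measurable_fun setT seed.
Proof. by []. Qed.

Let pulls_le := pull_event_le mseed mpol mlearner nu01 rewards.
Let diffs_le := diff_event_le mseed mpol mlearner nu01 rewards.

(** Indexed by an arm, a number of pulls shifted by one so as to range over 1 to [T], and the sign
    of the deviation. *)
Let bad_pulls : set Omega := \big[setU/set0]_(p <- enum {: 'I_K * 'I_T * bool})
  pull_event T nu seed X pol learner p.1.1 p.1.2.+1
    ((-1) ^+ p.2 * (4 * Num.sqrt (L / p.1.2.+1%:R))) (2 * L).

Let bad_diffs (k1 : 'I_K) : set Omega := \big[setU/set0]_(k <- enum 'I_K)
  diff_event T nu seed X pol learner k
    (gap nu kstar (if k == kstar then k1 else k)) l.

Let measurable_bad_pulls : measurable bad_pulls.
Proof.
by apply: bigsetU_measurable => p _; apply: (proj1 (pulls_le _ _ _ _)).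
Qed.

Let measurable_bad_diffs k1 : measurable (bad_diffs k1).
Proof.
by apply: bigsetU_measurable => p _; apply: (proj1 (diffs_le _ _ _)).
Qed.

Let K2' : 2 <= K%:R :> R.
Proof. by rewrite ler_nat. Qed.

Let T1' : 1 <= T%:R :> R.
Proof. by rewrite ler1n. Qed.

Let Kp : 0 < K%:R :> R.
Proof. by rewrite ltr0n ltnW. Qed.

Let Tp : 0 < T%:R :> R.
Proof. by rewrite ltr0n. Qed.

(** There are [2 * K * T] events of probability at most [(delta / (2 * K * T)) ^+ 2] each; the sum
    [delta ^+ 2 / (2 * K * T)] is at most [delta / 4] as [K * T >= 2]. *)
Let P_bad_pulls : (P bad_pulls <= (delta / 4)%:E)%E.
Proof.
have /andP[d0 d1] := delta01.
apply: (@le_trans _ _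
    (expR (- (2 * L)) *+ size (enum {: 'I_K * 'I_T * bool}))%:E).
  by apply: probability_bigsetU_le => p; have [] := pulls_le p.1.1 p.1.2.+1
    ((-1) ^+ p.2 * (4 * Num.sqrt (L / p.1.2.+1%:R))) (2 * L).
have -> : size (enum {: 'I_K * 'I_T * bool}) = (K * T * 2)%N.
  by rewrite -cardE !card_prod !card_ord card_bool.
rewrite lee_fin -[leLHS]mulr_natr !natrM.
set y := 2 * K%:R * T%:R / delta.
have KT : 2 <= K%:R * T%:R :> R by rewrite -[leLHS]mulr1 ler_pM.
have y0 : 0 < y by rewrite divr_gt0// -mulrA; lra.
have -> : expR (- (2 * L)) = (y ^+ 2)^-1.
  rewrite expRN; congr _^-1.
  by rewrite mulr_natl mulr2n expRD lnK ?posrE.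
have -> : (y ^+ 2)^-1 * (K%:R * T%:R * 2) = delta ^+ 2 / (2 * (K%:R * T%:R)).
  by rewrite /y; field; rewrite ?(gt_eqF Kp) ?(gt_eqF Tp) ?(gt_eqF d0).
rewrite ler_pdivrMr; last by lra.
by nra.
Qed.

(** There are [K] events, each of probability at most [expR (- l) = delta / (2 * K)]. *)
Let P_bad_diffs k1 : (P (bad_diffs k1) <= (delta / 2)%:E)%E.
Proof.
have /andP[d0 d1] := delta01.
apply: (@le_trans _ _ (expR (- l) *+ size (enum 'I_K))%:E).
  by apply: probability_bigsetU_le => k; have [] := diffs_le k
    (gap nu kstar (if k == kstar then k1 else k)) l.
rewrite -cardE card_ord lee_fin -[leLHS]mulr_natr expRN lnK ?posrE; last first.
  by rewrite divr_gt0 ?mulr_gt0.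
rewrite le_eqVlt; apply/orP; left; apply/eqP; field.
by rewrite ?(gt_eqF Kp) ?(gt_eqF d0).
Qed.

Let in_bigsetU (J : choiceType) (s : seq J) (A : J -> set Omega) j w :
  j \in s -> A j w -> (\big[setU/set0]_(j <- s) A j) w.
Proof. by move=> js Aj; rewrite -bigcup_seq; exists j. Qed.

Let good_pseudo_regret w : ~ bad_pulls w ->
  total_attack learner pol (seed w) (x w) T <= C ->
  \sum_(t < T) gap nu kstar (I w t) <=
    65 * (\sum_(k < K | k != kstar) L / gap nu kstar k) + 8 * (K%:R * C).
Proof.
move=> good attack; have [L1 _ _ _] := ln_confidence K2 T0 delta01.
apply: (pseudo_regret_path_le C0 L1 order_valid best mu01 attack).
move=> k [//|n] b _ nT; rewrite leNgt; apply/negP => /ltW bad; apply: good.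
by apply: (in_bigsetU (j := (k, Ordinal nT, b))); rewrite ?mem_enum.
Qed.

Let good_realized_regret k1 w : k1 != kstar ->
  (forall k, k != kstar -> gap nu kstar k1 <= gap nu kstar k) ->
  ~ bad_pulls w -> ~ bad_diffs k1 w ->
  total_attack learner pol (seed w) (x w) T <= C ->
  realized_regret kstar (x w) (I w) T <=
    200 * (\sum_(k < K | k != kstar) ln (K%:R * T%:R / delta) / gap nu kstar k
           + K%:R * C).
Proof.
move=> k1k mink gp gd attack; have [L1 L2 l2 l0] := ln_confidence K2 T0 delta01.
have dev k : \sum_(s < T) diff_increment mu k
    (gap nu kstar (if k == kstar then k1 else k)) (x w) s
    (map fst (transcript learner pol (seed w) (x w) s.+1)) <= l.
  rewrite leNgt; apply/negP => /ltW bad; apply: gd.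
  by apply: (in_bigsetU (j := k)); rewrite ?mem_enum.
apply: le_trans (realized_regret_path_le best l0 k1k mink dev) _.
have := good_pseudo_regret gp attack; rewrite -/I.
set S := \sum_(k < K | k != kstar) ln (K%:R * T%:R / delta) / gap nu kstar k.
have SL (y : R) : y <= 2 * ln (K%:R * T%:R / delta) ->
    \sum_(k < K | k != kstar) y / gap nu kstar k <= 2 * S.
  move=> yl; rewrite mulr_sumr; apply: ler_sum => k kk.
  by rewrite mulrA ler_pM2r// invr_gt0 gap_gt0.
have := SL _ L2; have := SL _ l2.
have S0 : 0 <= S.
  apply: sumr_ge0 => k kk; rewrite divr_ge0 ?(ltW (gap_gt0 kk))//; lra.
have KC : 0 <= K%:R * C by rewrite mulr_ge0.
(* The total is [3 / 2 * (130 * S + 8 * K * C) + 2 * S = 197 * S + 12 * K * C]. *)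
rewrite -/L -/l; lra.
Qed.

Let measurable_I (f : 'I_K -> Omega -> R) t :
  (forall k, measurable_fun setT (f k)) ->
  measurable_fun setT (fun w => f (I w t) w).
Proof.
move=> mf; apply: (measurable_fun_finitely_measurable_bind (f := I ^~ t)) => //.
apply: (finitely_measurable_pulled (X := fun k t w => X k t w) mpol mseed _ k0)
  => //.
by move=> o; exact: mlearner.
Qed.

Let measurable_good (b : R) :
  measurable [set w | realized_regret kstar (x w) (I w) T <= b].
Proof.
have -> : [set w | realized_regret kstar (x w) (I w) T <= b] =
    \bigcap_(k in setT) [set w | \sum_(t < T) (x w k t - x w (I w t) t) <= b].
  apply/seteqP; split=> [w /max_arm_le h k _|w h]; first exact: h.
  by apply/max_arm_le => k; exact: h.
apply: fin_bigcap_measurable => // k _.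
have ms : measurable_fun setT (fun w => \sum_(t < T) (x w k t - x w (I w t) t)).
  apply: measurable_sum => t; apply: measurable_funB => //.
  exact: (measurable_I (f := fun k w => x w k t)).
have := measurable_fun_ler ms (measurable_cst b).
by move=> /(_ measurableT [set true] Logic.I); rewrite setTI.
Qed.

Hypothesis attack :
  {ae P, forall w, total_attack learner pol (seed w) (x w) T <= C}.

Lemma realized_regret_whp :
  ((1 - delta)%:E <= P [set w | (realized_regret kstar (x w) (I w) T <=
    200 * (\sum_(k < K | k != kstar) ln (K%:R * T%:R / delta) / gap nu kstar k
           + K%:R * C))%R])%E.
Proof.
set good := [set w | _]; have mgood : measurable good by exact: measurable_good.
have /andP[d0 d1] := delta01.
(* As [K >= 2] there is a suboptimal arm, hence one of smallest gap, [k1]. *)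
have /card_gt0P[j0 j0k] : (0 < #|predC1 kstar|)%N.
  by rewrite cardC1 card_ord -ltnS prednK// ltnW.
have [k1 k1k mink] := arg_minP (gap nu kstar) j0k.
have [N [mN PN NS]] := attack.
have mB : measurable (bad_pulls `|` bad_diffs k1 `|` N).
  by apply: measurableU => //; exact: measurableU.
have PB : (P (bad_pulls `|` bad_diffs k1 `|` N) <= delta%:E)%E.
  apply: le_trans (measureU2 _ _ _) _ => //; first exact: measurableU.
  rewrite [X in (_ + X)%E]PN adde0.
  apply: le_trans (measureU2 _ _ _) _ => //.
  apply: le_trans (leeD P_bad_pulls (P_bad_diffs k1)) _.
  by rewrite -EFinD lee_fin; lra.
apply: (@le_trans _ _ (P (~` (bad_pulls `|` bad_diffs k1 `|` N)))).
  rewrite probability_setC// EFinB leeB//.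
apply: le_measure; rewrite ?inE//; first exact: measurableC.
move=> w /= h; apply: (good_realized_regret k1k) => [k|||].
- exact: mink.
- by move=> b; apply: h; left; left.
- by move=> b; apply: h; left; right.
- by apply: contrapT => b; apply: h; right; apply: NS.
Qed.

(** The path bound [b] holds off an event of probability at most [delta / 4], and the regret never
    exceeds [T]. The mean is thus at most [b + T * delta / 4 = b + K / 4]. *)
Lemma pseudo_regret_le : (K < T)%N -> delta = K%:R / T%:R ->
  (pseudo_regret P nu kstar I T <=
    (200 * (\sum_(k < K | k != kstar) ln T%:R / gap nu kstar k
            + K%:R * C))%:E)%E.
Proof.
move=> KT dE; have [N [mN PN NS]] := attack.
have [L1 _ _ _] := ln_confidence K2 T0 delta01.
set S := \sum_(k < K | k != kstar) ln T%:R / gap nu kstar k.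
pose f w := \sum_(t < T) gap nu kstar (I w t).
have -> : pseudo_regret P nu kstar I T = (\int[P]_w (f w)%:E)%E.
  rewrite /pseudo_regret unlock; apply: eq_integral => w _; congr _%:E.
  by rewrite /f /gap sumrB sumr_const card_ord mulr_natl.
have gap0 k : 0 <= gap nu kstar k.
  have [->|/gap_gt0/ltW//] := eqVneq k kstar; by rewrite /gap subrr.
have mf : measurable_fun setT f.
  apply: measurable_sum => t.
  exact: (measurable_I (f := fun k _ => gap nu kstar k)).
have f0 w : 0 <= f w by exact: sumr_ge0.
have fT w : f w <= T%:R.
  rewrite -[leRHS]mulr1 -[in leRHS](card_ord T) -sumr_const mulr_suml.
  by apply: ler_sum => t _; rewrite mul1r.
set b := 65 * (\sum_(k < K | k != kstar) L / gap nu kstar k) + 8 * (K%:R * C).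
have b0 : 0 <= b.
  rewrite addr_ge0 ?mulr_ge0// sumr_ge0// => k kk.
  by rewrite divr_ge0// (le_trans ler01).
have mB : measurable (bad_pulls `|` N) by exact: measurableU.
have PB : (P (bad_pulls `|` N) <= (delta / 4)%:E)%E.
  apply: le_trans (measureU2 _ _ _) _ => //.
  by rewrite [X in (_ + X)%E]PN adde0.
have fb w : f w <= b + T%:R * \1_(bad_pulls `|` N) w.
  rewrite indicE; case: (boolP (w \in _)) => [_|].
    by rewrite mulr1 (le_trans (fT w))// lerDr.
  move=> /negP nb; rewrite mulr0 addr0; apply: good_pseudo_regret => [bad|].
    by apply: nb; rewrite inE; left.
  by apply: contrapT => bad; apply: nb; rewrite inE; right; exact: NS.
have m1 : measurable_fun setT (fun w => b + T%:R * \1_(bad_pulls `|` N) w).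
  by apply: measurable_funD => //; apply: measurable_funM.
apply: (@le_trans _ _ (\int[P]_w (b + T%:R * \1_(bad_pulls `|` N) w)%:E)%E).
  apply: ge0_le_integral => [//|w _|||w _]; rewrite ?lee_fin//;
    exact/measurable_EFinP.
under eq_integral do rewrite EFinD EFinM.
have m2 : measurable_fun setT (fun w => (\1_(bad_pulls `|` N) w)%:E : \bar R).
  exact/measurable_EFinP.
rewrite ge0_integralD//; last exact: measurable_funeM.
rewrite integral_cst// [X in (_ * X)%E]probability_setT mule1 ge0_integralZl//.
rewrite integral_indic// setIT.
apply: (@le_trans _ _ (b%:E + T%:R%:E * (delta / 4)%:E)%E).
  by rewrite leeD2l// lee_wpmul2l// lee_fin.
rewrite -EFinM -EFinD lee_fin.
have T2 : 2 <= T%:R :> R by rewrite ler_nat (leq_trans K2)// ltnW.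
(* For this [delta] the argument of the logarithm is [2 * T ^+ 2], at most [T ^+ 3]. *)
have LT : L <= 3 * ln T%:R.
  have -> : L = ln (2 * T%:R ^+ 2).
    by rewrite /L dE; congr ln; field; rewrite ?(gt_eqF Kp) ?(gt_eqF Tp).
  rewrite lnM ?posrE ?exprn_gt0//; try lra.
  rewrite lnXn; last by lra.
  have : ln 2 <= ln T%:R :> R by rewrite ler_ln ?posrE//; lra.
  lra.
have lnT : 1 / 2 <= ln T%:R :> R.
  by apply: le_trans (ln2_ge_half R) _; rewrite ler_ln ?posrE//; lra.
have SL : \sum_(k < K | k != kstar) L / gap nu kstar k <= 3 * S.
  rewrite mulr_sumr; apply: ler_sum => k kk.
  by rewrite mulrA ler_pM2r// invr_gt0 gap_gt0.
(* The residue is absorbed by [S]: each of its [K - 1 >= K / 2] terms is at least 1 / 2, as gaps are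
   at most 1. *)
have SK : K%:R / 4 <= S.
  apply: (@le_trans _ _ (\sum_(k < K | k != kstar) 1 / 2)).
    rewrite sumr_const (cardC1 kstar) card_ord -[leRHS]mulr_natr -subn1 natrB.
      by move: K2'; lra.
    exact: ltnW.
  apply: ler_sum => k kk; apply: (le_trans lnT).
  rewrite ler_pdivlMr ?gap_gt0// ler_piMr ?gap_le1//; lra.
have -> : T%:R * (delta / 4) = K%:R / 4.
  by rewrite dE; field; rewrite (gt_eqF Tp).
have KC : 0 <= K%:R * C by rewrite mulr_ge0.
move: SL SK KC; rewrite /b; have := Kp.
(* The total is at most [65 * 3 * S + S + 8 * K * C], within the factor 200. *)
by move: S (\sum_(k < K | _) _) (K%:R * C) => s y z K0 SL SK KC; lra.
Qed.

End main.

Theorem theorem6 (R : realType) :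
  exists c : R, 0 < c /\
  forall (K T : nat) (nu : 'I_K -> probability R R) (kstar : 'I_K)
         (d : measure_display) (Omega : measurableType d)
         (P : probability Omega R)
         (X : 'I_K -> nat -> {RV P >-> R})
         (dU : measure_display) (U : measurableType dU)
         (seed : {mfun Omega >-> U}) (pol : attack_policy R K U)
         (order : pull_order K) (k0 : 'I_K) (C delta : R),
    (2 <= K)%N -> (0 < T)%N ->
    unit_supported nu -> unique_best_arm nu kstar ->
    bandit_rewards T nu seed X ->
    measurable_policy pol -> valid_pull_order order ->
    0 <= C -> 0 < delta < 1 ->
    let learner := sewr T C delta order k0 in
    let x (w : Omega) (k : 'I_K) (t : nat) : R := X k t w in
    let I (w : Omega) (t : nat) : 'I_K :=
      pulled learner pol (seed w) (x w) t in
    {ae P, forall w, total_attack learner pol (seed w) (x w) T <= C} ->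
    ((1 - delta)%:E <=
       P [set w | (realized_regret kstar (x w) (I w) T <=
                   (c * (\sum_(k < K | k != kstar)
                          ln (K%:R * T%:R / delta) / gap nu kstar k
                        + K%:R * C)))%R])%E
    /\
    ((K < T)%N -> delta = K%:R / T%:R ->
     (pseudo_regret P nu kstar I T <=
       (c * (\sum_(k < K | k != kstar) ln T%:R / gap nu kstar k
             + K%:R * C))%:E)%E).
Proof.
exists 200; split=> [//|].
move=> K T nu kstar d Omega P X dU U seed pol order k0 C delta K2 T0 nu01 best.
move=> rewards mpol order_valid C0 delta01 learner x I attack.
split; first exact: realized_regret_whp.
exact: pseudo_regret_le.
Qed.
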